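(* Let $G$ be a group with identity $1$, let $R$ be an indecomposable commutative ring with unit and let $\mathscr G$, $\mathscr G'$ be Hausdorff ample $G$-graded groupoids. For $x\in\mathscr G^{(0)}$ let $H_x$ denote the isotropy group at $x$ of the interior of the isotropy bundle of $\mathscr G_1$ (the homogeneous component of $1$). Suppose that the set of objects $x\in \mathscr G^{(0)}$ for which the group algebra $RH_x$ has no non-trivial units is dense in $\mathscr G^{(0)}$. Then the following are equivalent. (1) There is a graded isomorphism $\varphi\colon \mathscr G\to \mathscr G'$. (2) There is a diagonal-preserving graded isomorphism $\Phi\colon R\mathscr G\to R\mathscr G'$ of $R$-algebras. (3) There is a diagonal-preserving graded isomorphism $\Phi\colon R\mathscr G\to R\mathscr G'$ of rings.
   Context: A commutative ring $R$ with unit is indecomposable if $0\neq 1$ and $0,1$ are its only idempotents. A group ring $RH$ has no non-trivial units if $(RH)^\times=\{rh\mid r\in R^\times, h\in H\}$. Groupoids. A groupoid $\mathscr G$ is a small category with all arrows invertible; $\mathscr G^{(0)}$ is the set of objects (identified with the identity arrows), $\mathscr G^{(1)}$ the set of arrows, $\boldsymbol d,\boldsymbol r$ the domain and range maps; $\alpha\beta$ is defined when $\boldsymbol d(\alpha)=\boldsymbol r(\beta)$. A topological groupoid has topologies making all structure maps continuous; it is étale if $\boldsymbol d$ is a local homeomorphism (then all structure maps are, and $\mathscr G^{(0)}$ is open in $\mathscr G^{(1)}$). A Boolean space is a Hausdorff space with a basis of compact open sets. An ample groupoid is an étale groupoid with $\mathscr G^{(0)}$ a Boolean space; it is Hausdorff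 if $\mathscr G^{(1)}$ is Hausdorff. An isomorphism of topological groupoids is a continuous functor with a continuous inverse. The isotropy bundle is the subgroupoid of all arrows $\gamma$ with $\boldsymbol d(\gamma)=\boldsymbol r(\gamma)$; its topological interior is an open étale subgroupoid containing $\mathscr G^{(0)}$. The isotropy group of a groupoid at $x$ is the group of its arrows with domain and range $x$. Gradings. A $G$-graded groupoid is a topological groupoid with a continuous functor (cocycle) $c\colon\mathscr G\to G$, $G$ being a discrete one-object groupoid; $\mathscr G_g=c^{-1}(g)$ for $g\in G$. $\mathscr G_1$ is a clopen subgroupoid. A graded isomorphism of $G$-graded groupoids is an isomorphism of topological groupoids commuting with the cocycles. Groupoid algebra. $R\mathscr G$ is the $R$-module of compactly supported locally constant functions $\mathscr G^{(1)}\to R$ with product $fg(\gamma)=\sum_{\boldsymbol d(\alpha)=\boldsymbol d(\gamma)}f(\gamma\alpha^{-1})g(\alpha)$. It is $G$-graded, the component $R\mathscr G_g$ consisting of the functions supported on $\mathscr G_g$. The diagonal subalgebra $D(\mathscr G)$ is the set of functions supported on $\mathscr G^{(0)}$. An isomorphism $\Phi\colon R\mathscr G\to R\mathscr G'$ is diagonal-preserving if $\Phi(D(\mathscr G))=D(\mathscr G')$, and graded if $\Phi(R\mathscr G_g)=R\mathscr G'_g$ for all $g\in G$. *)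

(* Defs.v *)
From HB Require Import structures.
From mathcomp Require Import all_boot all_algebra.
From mathcomp Require Import all_classical topology.

Set Implicit Arguments.
Unset Strict Implicit.
Unset Printing Implicit Defensive.

Import GRing.Theory.

Local Open Scope classical_set_scope.
Local Open Scope ring_scope.

(* The requirement 0 != 1 is part of comNzRingType. *)
Definition indecomposable (R : comNzRingType) :=
  forall e : R, e * e = e -> e = 0 \/ e = 1.

Definition supp (T : Type) (R : nzRingType) (f : T -> R) : set T :=
  [set t | f t != 0].

Section GroupRing.
Variables (R : comNzRingType) (H : groupType).
Implicit Types f g : H -> R.

Definition group_ring : set (H -> R) := [set f | finite_set (supp f)].

Definition gr_monomial (r : R) (h : H) : H -> R :=
  fun k => if k == h then r else 0.

(* \sum_(k \in A) is the sum over the support of the summand, which is finite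
   when f and g are in group_ring. *)
Definition gr_mul f g : H -> R :=
  fun h => \sum_(k \in [set: H]) f (h * k^-1)%g * g k.

Definition gr_units : set (H -> R) :=
  [set f | group_ring f /\ exists2 g, group_ring g &
     gr_mul f g = gr_monomial 1 1%g /\ gr_mul g f = gr_monomial 1 1%g].

Definition no_nontrivial_units :=
  gr_units = [set f | exists r h, (exists s : R, r * s = 1) /\ f = gr_monomial r h].

End GroupRing.

(* Composition is a total function; gmul a b is meaningful only when
   dom a = rng b, and is unconstrained otherwise. *)
Record topGroupoid := TopGroupoid {
  obj : topologicalType;
  arr : topologicalType;
  dom : arr -> obj;
  rng : arr -> obj;
  idn : obj -> arr;
  gmul : arr -> arr -> arr;
  ginv : arr -> arr;
  dom_idn : forall x, dom (idn x) = x;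
  rng_idn : forall x, rng (idn x) = x;
  dom_mul : forall a b, dom a = rng b -> dom (gmul a b) = dom b;
  rng_mul : forall a b, dom a = rng b -> rng (gmul a b) = rng a;
  gmulA : forall a b c, dom a = rng b -> dom b = rng c ->
    gmul a (gmul b c) = gmul (gmul a b) c;
  gmul_idl : forall a, gmul (idn (rng a)) a = a;
  gmul_idr : forall a, gmul a (idn (dom a)) = a;
  dom_inv : forall a, dom (ginv a) = rng a;
  rng_inv : forall a, rng (ginv a) = dom a;
  gmulVa : forall a, gmul (ginv a) a = idn (dom a);
  gmulaV : forall a, gmul a (ginv a) = idn (rng a);
  dom_continuous : continuous dom;
  rng_continuous : continuous rng;
  idn_continuous : continuous idn;
  ginv_continuous : continuous ginv;
  gmul_continuous : {within [set p : arr * arr | dom p.1 = rng p.2],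
                      continuous (fun p => gmul p.1 p.2)}
}.

Arguments dom {t} _.
Arguments rng {t} _.
Arguments idn {t} _.
Arguments gmul {t} _ _.
Arguments ginv {t} _.

Definition local_homeomorphism (X Y : topologicalType) (f : X -> Y) :=
  forall x, exists U : set X, [/\ open U, U x, open (f @` U),
    {within U, continuous f} &
    exists g : Y -> X, {within f @` U, continuous g} /\ {in U, cancel f g}].

Definition etale (E : topGroupoid) := local_homeomorphism (@dom E).

Definition boolean_space (X : topologicalType) :=
  hausdorff_space X /\ exists2 B : set (set X), basis B & B `<=` @compact X.

Definition ample (E : topGroupoid) := etale E /\ boolean_space (obj E).

Record gradedGroupoid (G : groupType) := GradedGroupoid {
  gpd :> topGroupoid;
  deg : arr gpd -> G;
  deg_continuous : continuous (deg : arr gpd -> discrete_topology G);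
  degM : forall a b, dom a = rng b -> deg (gmul a b) = (deg a * deg b)%g
}.

Arguments deg {G g} _.

Record groupoidFunctor (E F : topGroupoid) := GroupoidFunctor {
  fobj : obj E -> obj F;
  farr : arr E -> arr F;
  farr_dom : forall a, dom (farr a) = fobj (dom a);
  farr_rng : forall a, rng (farr a) = fobj (rng a);
  farr_idn : forall x, farr (idn x) = idn (fobj x);
  farr_mul : forall a b, dom a = rng b ->
    farr (gmul a b) = gmul (farr a) (farr b)
}.

Definition continuous_functor (E F : topGroupoid) (phi : groupoidFunctor E F) :=
  continuous (fobj phi) /\ continuous (farr phi).

Definition groupoid_iso (E F : topGroupoid) (phi : groupoidFunctor E F) :=
  continuous_functor phi /\
  exists psi : groupoidFunctor F E,
    [/\ continuous_functor psi,
        cancel (fobj phi) (fobj psi), cancel (fobj psi) (fobj phi),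
        cancel (farr phi) (farr psi) & cancel (farr psi) (farr phi)].

Definition graded_groupoid_iso (G : groupType) (E F : gradedGroupoid G)
    (phi : groupoidFunctor E F) :=
  groupoid_iso phi /\ forall a, deg (farr phi a) = deg a.

Section Isotropy.
Variables (G : groupType) (E : gradedGroupoid G).

Definition isotropy1 : set (arr E) :=
  [set a | deg a = 1%g /\ dom a = rng a].

(* The arrows of degree 1 form an open set (deg is continuous), so the interior
   taken among them agrees with the interior taken in the space of all arrows. *)
Definition int_isotropy1 : set (arr E) := interior isotropy1.

Lemma deg_idn (x : obj E) : deg (idn x : arr E) = 1%g.
Proof.
have e : dom (idn x : arr E) = rng (idn x) by rewrite dom_idn rng_idn.
have := degM e; have := gmul_idr (idn x : arr E); rewrite dom_idn => ->.
by rewrite -[X in X = _]mulg1 => /mulgI/esym.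
Qed.

Lemma int_isotropy1P a : int_isotropy1 a -> deg a = 1%g /\ dom a = rng a.
Proof. exact: interior_subset. Qed.

Hypothesis etE : etale E.

Lemma local_section (b : arr E) : exists s : obj E -> arr E,
  [/\ {for dom b, continuous s}, s (dom b) = b &
      \forall y \near dom b, dom (s y) = y].
Proof.
have [U [oU Ub odU _ [s [cs sK]]]] := etE b.
have nU : nbhs (dom b) (dom @` U) by apply: open_nbhs_nbhs; split => //; exists b.
exists s; split.
- by have := cs (dom b); rewrite /continuous_at -nbhs_subspace_interior.
- by apply: sK; rewrite inE.
- by apply: filterS nU => y [a Ua <-]; rewrite sK ?inE.
Qed.

Lemma int_isotropy1_idn x : int_isotropy1 (idn x).
Proof.
have [U [oU Ux _ _ [s [_ sK]]]] := etE (idn x).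
have nU : nbhs (idn x : arr E) U by exact: open_nbhs_nbhs.
have nV : \forall a \near (idn x : arr E), U (idn (dom a)).
  have c : (idn \o dom : arr E -> arr E) @ (idn x : arr E) --> (idn x : arr E).
    rewrite -[X in _ --> X]/(idn x) -{2}(dom_idn x).
    apply: continuous_comp; first exact: dom_continuous.
    exact: idn_continuous.
  exact: c.
rewrite /int_isotropy1 /interior; near=> a.
have ea : idn (dom a) = a.
  have Ua : U a by near: a.
  have Uda : U (idn (dom a)) by near: a; exact: nV.
  by rewrite -[RHS]sK ?inE// -{2}(dom_idn (dom a)) sK ?inE.
by split; rewrite -ea ?deg_idn// dom_idn rng_idn.
Unshelve. all: by end_near.
Qed.

Lemma ginvK : involutive (@ginv E).
Proof.
move=> a; rewrite -[LHS]gmul_idr dom_inv rng_inv -gmulVa gmulA; last 2 first.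
- by rewrite dom_inv.
- by rewrite dom_inv.
by rewrite gmulVa dom_inv gmul_idl.
Qed.

Lemma deg_inv (a : arr E) : deg (ginv a) = (deg a)^-1%g.
Proof.
have := degM (dom_inv a); rewrite gmulVa deg_idn => e.
by rewrite -[LHS](mulgK (deg a)) -e mul1g.
Qed.

Lemma int_isotropy1V a : int_isotropy1 a -> int_isotropy1 (ginv a).
Proof.
rewrite /int_isotropy1 /interior -{1}(ginvK a) => ia.
have n : \forall b \near ginv a, isotropy1 (ginv b).
  exact: (@ginv_continuous E (ginv a) _ ia).
apply: filterS n => b /= [d1 e]; move: d1 e.
rewrite /isotropy1 /= deg_inv dom_inv rng_inv => d1 e.
by split; [apply: invg_inj; rewrite d1 invg1 | rewrite e].
Qed.

Lemma int_isotropy1M a b : dom a = rng b ->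
  int_isotropy1 a -> int_isotropy1 b -> int_isotropy1 (gmul a b).
Proof.
move=> ab ia ib; have [s [cs sb ds]] := local_section b.
have dab := dom_mul ab.
set t := fun c : arr E => s (dom c).
have tab : t (gmul a b) = b by rewrite /t dab.
have ct : t @ gmul a b --> b.
  rewrite -{2}tab; apply: continuous_comp; first exact: dom_continuous.
  by rewrite dab.
have dt : \forall c \near gmul a b, dom (t c) = dom c.
  by rewrite -dab in ds; exact: (@dom_continuous E (gmul a b) _ ds).
have abK : gmul (gmul a b) (ginv b) = a.
  by rewrite -gmulA ?rng_inv// gmulaV -ab gmul_idr.
pose D := [set p : arr E * arr E | dom p.1 = rng p.2].
have cp : (fun c => (c, ginv (t c))) @ gmul a b
    --> within D (nbhs (gmul a b, ginv b)).
  have cv : (ginv \o t) @ gmul a b --> ginv b.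
    by apply: cvg_comp ct _; exact: ginv_continuous.
  have cu := cvg_pair (@cvg_id _ (nbhs (gmul a b))) cv.
  move=> P /cu; apply: filterS2 dt => c e; apply.
  by rewrite /D /= rng_inv.
have cm : (fun c => gmul c (ginv (t c))) @ gmul a b --> a.
  rewrite -{2}abK.
  have Dp : D (gmul a b, ginv b) by rewrite /D /= dab rng_inv.
  have := @gmul_continuous E (gmul a b, ginv b).
  rewrite /continuous_at/= /nbhs/= -nbhs_subspace_in//.
  by apply: cvg_trans; apply: cvg_app cp.
have n1 := ct _ ib; have n2 := cm _ ia.
rewrite /int_isotropy1 /interior; near=> c.
have [d1 e1] : isotropy1 (t c) by near: c; exact: n1.
have [d2 e2] : isotropy1 (gmul c (ginv (t c))) by near: c; exact: n2.
have dc : dom (t c) = dom c by near: c; exact: dt.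
have cc : dom c = rng (ginv (t c)) by rewrite rng_inv.
split.
  by move: d2; rewrite (degM cc) deg_inv d1 invg1 mulg1.
by move: e2; rewrite (dom_mul cc) (rng_mul cc) dom_inv -e1 dc.
Unshelve. all: by end_near.
Qed.

End Isotropy.

Definition isotropy_set (G : groupType) (E : gradedGroupoid G) (x : obj E) :
  set (arr E) := [set a | int_isotropy1 a /\ dom a = x].

(* int_isotropy1 contains the identity arrows and is closed under composition
   because E is etale, whence the argument of type etale E. *)
Definition isotropy_group (G : groupType) (E : gradedGroupoid G)
  (etE : etale E) (x : obj E) : Type := isotropy_set x.

Section IsotropyGroup.
Variables (G : groupType) (E : gradedGroupoid G) (etE : etale E) (x : obj E).

HB.instance Definition _ :=
  Choice.copy (isotropy_group etE x) (set_type (isotropy_set x)).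

Implicit Types h k l : isotropy_group etE x.

Lemma isoP h : [/\ int_isotropy1 (val h), dom (val h) = x & rng (val h) = x].
Proof.
have := valP h; rewrite inE => -[ih dh].
by have [_ <-] := int_isotropy1P ih.
Qed.

Lemma iso_composable h k : dom (val h) = rng (val k).
Proof. by have [_ -> _] := isoP h; have [_ _ ->] := isoP k. Qed.

Fact iso_one_subproof : (idn x : arr E) \in isotropy_set x.
Proof. by rewrite inE; split; [exact: int_isotropy1_idn|exact: dom_idn]. Qed.

Fact iso_mul_subproof h k :
  gmul (val h) (val k) \in isotropy_set x.
Proof.
have c := iso_composable h k; have [ih _ _] := isoP h; have [ik dk _] := isoP k.
by rewrite inE; split; [exact: int_isotropy1M | rewrite dom_mul].
Qed.

Fact iso_inv_subproof h :
  ginv (val h) \in isotropy_set x.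
Proof.
have [ih _ rh] := isoP h.
by rewrite inE; split; [exact: int_isotropy1V | rewrite dom_inv].
Qed.

Definition iso_one : isotropy_group etE x := SigSub iso_one_subproof.
Definition iso_mul h k : isotropy_group etE x := SigSub (iso_mul_subproof h k).
Definition iso_inv h : isotropy_group etE x := SigSub (iso_inv_subproof h).

Fact iso_mulA : associative iso_mul.
Proof. by move=> h k l; apply: val_inj; rewrite /= gmulA//; exact: iso_composable. Qed.

Fact iso_mul1 : left_id iso_one iso_mul.
Proof.
by move=> h; apply: val_inj; have [_ _ rh] := isoP h; have := gmul_idl (val h); rewrite rh.
Qed.

Fact iso_mulr1 : right_id iso_one iso_mul.
Proof.
by move=> h; apply: val_inj; have [_ dh _] := isoP h; have := gmul_idr (val h); rewrite dh.
Qed.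

Fact iso_mulV : left_inverse iso_one iso_inv iso_mul.
Proof. by move=> h; apply: val_inj; have [_ dh _] := isoP h; rewrite /= gmulVa dh. Qed.

Fact iso_mulrV : right_inverse iso_one iso_inv iso_mul.
Proof. by move=> h; apply: val_inj; have [_ _ rh] := isoP h; rewrite /= gmulaV rh. Qed.

HB.instance Definition _ := isGroup.Build (isotropy_group etE x)
  iso_mulA iso_mul1 iso_mulr1 iso_mulV iso_mulrV.

End IsotropyGroup.

Section GroupoidAlgebra.
Variables (R : comNzRingType) (E : topGroupoid).
Implicit Types f g : arr E -> R.

Definition locally_constant f := forall a, \forall b \near a, f b = f a.

Definition groupoid_algebra : set (arr E -> R) :=
  [set f | locally_constant f /\ compact (closure (supp f))].

(* For f and g in groupoid_algebra and E etale, finitely many terms are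
   nonzero. *)
Definition conv f g : arr E -> R :=
  fun c => \sum_(a \in [set a | dom a = dom c]) f (gmul c (ginv a)) * g a.

Definition diagonal : set (arr E -> R) :=
  [set f | groupoid_algebra f /\ supp f `<=` range idn].

End GroupoidAlgebra.

Definition homogeneous (R : comNzRingType) (G : groupType)
    (E : gradedGroupoid G) (g : G) : set (arr E -> R) :=
  [set f | groupoid_algebra f /\ supp f `<=` deg @^-1` [set g]].

(* Maps between groupoid algebras are maps between the ambient function types;
   only their values on groupoid_algebra matter. *)
Section AlgebraIso.
Variables (R : comNzRingType) (G : groupType) (E F : gradedGroupoid G).
Variable Phi : (arr E -> R) -> (arr F -> R).

Definition ring_iso :=
  [/\ set_bij (@groupoid_algebra R E) (@groupoid_algebra R F) Phi,
      {in @groupoid_algebra R E &, {morph Phi : f g / f \+ g}} &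
      {in @groupoid_algebra R E &, {morph Phi : f g / conv f g}}].

Definition algebra_iso :=
  ring_iso /\
  forall r : R, {in @groupoid_algebra R E, {morph Phi : f / r \*o f}}.

Definition diagonal_preserving := Phi @` @diagonal R E = @diagonal R F.

Definition graded_map :=
  forall g : G, Phi @` @homogeneous R G E g = @homogeneous R G F g.

End AlgebraIso.

(* Main.v *)
(* Let Psi : RE' -> RE be the inverse of a diagonal-preserving graded ring
   isomorphism. As R is indecomposable, Psi permutes the indicators of compact
   open sets of objects, and this yields a homeomorphism h of the object spaces.
   For a homogeneous compact open bisection U of E', the function f = Psi(1_U)
   normalizes the diagonal, so an arrow in its support has the source and range
   prescribed by U through h. Two arrows of the support with a common source x
   thus differ by an element of H_x, and f restricted to the arrows from x is a
   translate of a unit of RH_x. For x in the given dense set it is therefore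
   carried by a single arrow; as E is Hausdorff and the support is open, the same
   holds for all x. Sending an arrow of U to the arrow of supp Psi(1_U) with the
   corresponding source defines a graded isomorphism E' -> E. *)

(* In the lemmas [F] stands for [E']. The density hypothesis concerns [E] alone, so the functions to
   be shown concentrated must lie in the algebra of [E]; hence indicators of bisections of [F] are
   pushed through [Psi], and this argument cannot be repeated with the groupoids exchanged.
   Injectivity on arrows is therefore proved separately: the kernel is trivial because [Phi] also
   preserves the diagonal.

   [Psi] is only additive and multiplicative, so whatever is transported must be phrased with
   products: restricting sources or ranges to [K] is convolution with the indicator of the units
   over [K], and a scalar is absorbed into a diagonal function.

   [R] may have zero divisors, so non-zero values cannot simply be multiplied. Once [Psi] of the
   indicator of [U] is carried by one arrow per source, its convolution with the function of the
   inverse bisection has a single term, equal to 1; its non-zero values are thus units of [R], and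
   this makes the correspondence of arrows multiplicative. *)
Require Import Defs.
From mathcomp Require Import all_boot all_algebra.
From mathcomp Require Import all_classical topology.

Set Implicit Arguments.
Unset Strict Implicit.
Unset Printing Implicit Defensive.

Import GRing.Theory.

Local Open Scope classical_set_scope.
Local Open Scope ring_scope.

(** * Compact open sets and Stone duality *)

Section CompactOpen.
Variable X : topologicalType.
Implicit Types K L : set X.

(** If [P A] failed, the sets whose complement in [A] satisfies [P] would form a proper filter
    containing [A]; the neighbourhood given at a cluster point contradicts clustering. *)
Lemma compact_ind (P : set X -> Prop) (A : set X) : compact A ->
  P set0 -> (forall B C, C `<=` B -> P B -> P C) ->
  (forall B C, P B -> P C -> P (B `|` C)) ->
  (forall a, A a -> exists2 U, nbhs a U & P U) -> P A.
Proof.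
move=> cA P0 PS PU Ploc; apply: contrapT => nPA.
pose F : set_system X := [set B | P (A `\` B)].
have FF : ProperFilter F.
  apply: Build_ProperFilter; first by rewrite /F /= setD0.
  split=> [|B C|B C]; rewrite /F /=.
  - by rewrite setDT.
  - by move=> PB PC; rewrite setDIr; exact: PU.
  - by move=> BC; apply: PS => a [Aa nC]; split => // /BC.
have [|a [Aa cl]] := cA F FF; first by rewrite /F/= setDv.
have [U nU PU'] := Ploc a Aa.
have [|b []//] := cl (~` U) U _ nU.
by rewrite /F /=; apply: PS PU' => b [_] /contrapT.
Qed.

Definition cpt_open K := open K /\ compact K.

Lemma cpt_open_nbhs x A : boolean_space X -> nbhs x A ->
  exists K, [/\ cpt_open K, K x & K `<=` A].
Proof.
move=> [_ [B [Bo Bb] Bc]] /Bb [K [BK Kx] KA].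
by exists K; split => //; split; [exact: Bo | exact: Bc].
Qed.

Hypothesis hX : hausdorff_space X.

Lemma cpt_open_closed K : cpt_open K -> closed K.
Proof. by move=> [_]; exact: compact_closed. Qed.

Lemma cpt_openI K L : cpt_open K -> open L -> closed L -> cpt_open (K `&` L).
Proof.
move=> [oK cK] oL cL; split; first exact: openI.
apply: (subclosed_compact _ cK) => //.
by apply: closedI => //; exact: compact_closed.
Qed.

Lemma cpt_openII K L : cpt_open K -> cpt_open L -> cpt_open (K `&` L).
Proof.
move=> cK cL; apply: cpt_openI => //; first exact: cL.1.
exact: cpt_open_closed.
Qed.

Lemma cpt_openD K L : cpt_open K -> cpt_open L -> cpt_open (K `\` L).
Proof.
move=> cK cL; rewrite setDE; apply: cpt_openI => //.
  by apply: closed_openC; exact: cpt_open_closed.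
by apply: open_closedC; exact: cL.1.
Qed.

End CompactOpen.

(* Stone duality for compact open sets: [T] is a lattice isomorphism onto the
   compact open sets of [X], so each point of [X] is carried by a point of [Y]. *)
Lemma boolean_correspondence (X Y : topologicalType) (T : set Y -> set X) :
  boolean_space X -> boolean_space Y ->
  (forall K, cpt_open K -> cpt_open (T K)) ->
  (forall L, cpt_open L -> exists2 K, cpt_open K & T K = L) ->
  (forall K, cpt_open K -> T K = set0 -> K = set0) -> T set0 = set0 ->
  (forall K L, cpt_open K -> cpt_open L -> T (K `&` L) = T K `&` T L) ->
  forall x, exists y, forall K, cpt_open K -> (K y <-> T K x).
Proof.
move=> bX bY cT sT iT T0 TI x; have [hX _] := bX; have [hY _] := bY.
have [L0 [cL0 L0x _]] := cpt_open_nbhs bX (@filterT _ (nbhs x) _).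
have [K0 cK0 K0L0] := sT _ cL0.
have [y yP] : exists y, forall K, cpt_open K -> T K x -> K y.
  apply: contrapT => /forallNP nP.
  (* If no point lay in every [K] with [T K x], compactness of [K0] would give one such [K] missing
     [K0], while [x] lies in both [T K] and [T K0]. *)
  pose P (B : set Y) := exists K, [/\ cpt_open K, T K x & K `&` B = set0].
  have : P K0.
    apply: (compact_ind cK0.2).
    - by exists K0; rewrite setI0 K0L0.
    - move=> B C CB [K [cK Kx KB]]; exists K; split => //.
      by rewrite -subset0 -KB => a [Ka /CB Ba]; split.
    - move=> B C [K [cK Kx KB]] [L [cL Lx LC]]; exists (K `&` L); split.
      + exact: cpt_openII.
      + by rewrite TI//; split.
      + rewrite -subset0 => a [[Ka La] [Ba|Ca]]; first by rewrite -KB; split.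
        by rewrite -LC; split.
    - move=> a K0a; have /existsNP[K /not_implyP[cK /not_implyP[Kx nKa]]] := nP a.
      exists (~` K); last by exists K; split => //; rewrite setICr.
      apply: open_nbhs_nbhs; split => //.
      by apply: closed_openC; exact: cpt_open_closed.
  move=> [K [cK Kx KK0]]; have : T (K `&` K0) x by rewrite TI// K0L0; split.
  by rewrite KK0 T0.
exists y => K cK; split; last exact: yP.
move=> Ky; apply: contrapT => nKx.
(* The complement of [T K] in [L0] contains [x] and is some [T M']; so [y] lies in [M'], yet [M'] is
   disjoint from [K]. *)
have cM : cpt_open (L0 `\` T K) by apply: cpt_openD => //; exact: cT.
have [M' cM' M'E] := sT _ cM.
have M'y : M' y by apply: yP => //; rewrite M'E; split.
have : M' `&` K = set0.
  apply: iT; first exact: cpt_openII.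
  by rewrite TI// M'E setDE -setIA setICl setI0.
by rewrite -subset0 => /(_ y); apply.
Qed.

(** * Groupoid identities, etale groupoids and compact open bisections *)

Section Groupoid.
Variables (G : groupType) (E : gradedGroupoid G).
Implicit Types a b c : arr E.

Lemma gmulVK a b : dom a = rng b -> gmul (ginv a) (gmul a b) = b.
Proof. by move=> e; rewrite gmulA ?dom_inv// gmulVa e gmul_idl. Qed.

Lemma gmulK a b : dom a = rng b -> gmul (gmul a b) (ginv b) = a.
Proof. by move=> e; rewrite -gmulA ?rng_inv// gmulaV -e gmul_idr. Qed.

Lemma gmulKV a b : dom a = dom b -> gmul (gmul a (ginv b)) b = a.
Proof. by move=> e; rewrite -gmulA ?rng_inv ?dom_inv// gmulVa -e gmul_idr. Qed.

Lemma gmulVKr a b : rng a = rng b -> gmul a (gmul (ginv a) b) = b.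
Proof. by move=> e; rewrite gmulA ?rng_inv ?dom_inv// gmulaV e gmul_idl. Qed.

Lemma ginvM a b : dom a = rng b -> ginv (gmul a b) = gmul (ginv b) (ginv a).
Proof.
move=> e; have ed : dom (ginv (gmul a b)) = rng (ginv (ginv a)).
  by rewrite dom_inv rng_inv rng_mul// dom_inv.
rewrite -[LHS](gmulK (b := a)) ?dom_inv ?rng_mul//; congr gmul.
rewrite -[LHS](gmulK (b := b)); last by rewrite dom_mul ?dom_inv ?rng_mul.
rewrite -[X in gmul X _]gmulA ?dom_inv ?rng_mul//.
by rewrite gmulVa dom_mul// -(rng_inv b) gmul_idl.
Qed.

End Groupoid.

Lemma closed_equalizer (X Y : topologicalType) (f g : X -> Y) :
  hausdorff_space Y -> continuous f -> continuous g -> closed [set x | f x = g x].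
Proof.
move=> hY cf cg; rewrite -[X in closed X]setCK; apply: open_closedC.
rewrite openE => x /= /eqP nfg; have := hY; rewrite open_hausdorff => /(_ _ _ nfg).
move=> [[A B] /= [/set_mem fA /set_mem gB] [oA oB AB]].
have nA : \forall y \near x, A (f y) by apply: cf; exact: open_nbhs_nbhs.
have nB : \forall y \near x, B (g y) by apply: cg; exact: open_nbhs_nbhs.
apply: filterS2 nA nB => y Ay By /= fg.
by move/eqP : AB; rewrite -subset0 => /(_ (f y)); apply; split=> //; rewrite fg.
Qed.

Section EtaleGroupoid.
Variables (G : groupType) (E : gradedGroupoid G).
Implicit Types (a b c : arr E) (U V : set (arr E)) (K : set (obj E)).

Definition sprod U V :=
  [set c | exists a b, [/\ U a, V b, dom a = rng b & c = gmul a b]].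

(* Compact open bisections on which the degree is constant. *)
Definition bisection U :=
  [/\ cpt_open U, set_inj U (@dom E), set_inj U (@rng E) &
      exists g, forall a, U a -> deg a = g].

Lemma bisectionS U V : bisection U -> cpt_open V -> V `<=` U -> bisection V.
Proof.
move=> [_ Ud Ur [g Ug]] cV VU; split => //.
- by apply: sub_in2 Ud => a; rewrite !inE; exact: VU.
- by apply: sub_in2 Ur => a; rewrite !inE; exact: VU.
- by exists g => a /VU/Ug.
Qed.

Hypothesis ampleE : ample E.

Let etE : etale E := ampleE.1.
Let bX : boolean_space (obj E) := ampleE.2.
Let hX : hausdorff_space (obj E) := bX.1.

(** Near a unit, [a] and [idn (dom a)] lie in one open set on which [dom] is injective, and they
    have the same source. *)
Lemma open_range_idn : open (range (@idn E)).
Proof.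
rewrite openE => _ [x _ <-].
have [U [oU Ux _ _ [s [_ sK]]]] := etE (idn x).
have nU : nbhs (idn x : arr E) U by exact: open_nbhs_nbhs.
have nV : \forall a \near (idn x : arr E), U (idn (dom a)).
  have c : (idn \o dom : arr E -> arr E) @ (idn x : arr E) --> (idn x : arr E).
    rewrite -[X in _ --> X]/(idn x) -{2}(dom_idn x).
    apply: continuous_comp; first exact: dom_continuous.
    exact: idn_continuous.
  exact: c.
apply: filterS2 nU nV => a Ua Uda; exists (dom a) => //.
by rewrite -[RHS]sK ?inE// -{2}(dom_idn (dom a)) sK ?inE.
Qed.

(** A section [s] of [dom] through [b], continuous there, provides [b' = s (dom c)], and the
    quotient of [c] by [b'] tends to [a]. This makes products of open sets open and convolutions
    locally constant. *)
Lemma near_factor a b (P Q : set (arr E)) : dom a = rng b -> nbhs a P -> nbhs b Q ->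
  \forall c \near gmul a b,
    exists b', [/\ Q b', dom b' = dom c & P (gmul c (ginv b'))].
Proof.
move=> ab nP nQ; have [s [cs sb ds]] := local_section etE b.
have dab := dom_mul ab.
set t := fun c : arr E => s (dom c).
have tab : t (gmul a b) = b by rewrite /t dab.
have ct : t @ gmul a b --> b.
  rewrite -{2}tab; apply: continuous_comp; first exact: dom_continuous.
  by rewrite dab.
have dt : \forall c \near gmul a b, dom (t c) = dom c.
  by rewrite -dab in ds; exact: (@dom_continuous E (gmul a b) _ ds).
pose D := [set p : arr E * arr E | dom p.1 = rng p.2].
have cp : (fun c => (c, ginv (t c))) @ gmul a b
    --> within D (nbhs (gmul a b, ginv b)).
  have cv : (ginv \o t) @ gmul a b --> ginv b.
    by apply: cvg_comp ct _; exact: ginv_continuous.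
  have cu := cvg_pair (@cvg_id _ (nbhs (gmul a b))) cv.
  move=> O /cu; apply: filterS2 dt => c e; apply.
  by rewrite /D /= rng_inv.
have cm : (fun c => gmul c (ginv (t c))) @ gmul a b --> a.
  rewrite -{2}(gmulK ab).
  have Dp : D (gmul a b, ginv b) by rewrite /D /= dab rng_inv.
  have := @gmul_continuous E (gmul a b, ginv b).
  rewrite /continuous_at/= /nbhs/= -nbhs_subspace_in//.
  by apply: cvg_trans; apply: cvg_app cp.
have n1 := ct _ nQ; have n2 := cm _ nP.
by apply: filterS3 dt n1 n2 => c e Qc Pc; exists (t c).
Qed.

Lemma open_sprod U V : open U -> open V -> open (sprod U V).
Proof.
move=> oU oV; rewrite openE => _ [a [b [Ua Vb ab ->]]].
have := near_factor ab (open_nbhs_nbhs (conj oU Ua)) (open_nbhs_nbhs (conj oV Vb)).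
apply: filterS => c [b' [Vb' e Uc]]; exists (gmul c (ginv b')), b'; split => //.
  by rewrite dom_mul ?dom_inv ?rng_inv.
by rewrite gmulKV.
Qed.

Lemma compact_sprod U V : compact U -> compact V -> compact (sprod U V).
Proof.
move=> cU cV.
pose D := [set p : arr E * arr E | dom p.1 = rng p.2].
have cD : closed D.
  apply: (@closed_equalizer (arr E * arr E)%type (obj E)) => // p.
    by apply: continuous_comp; [exact: cvg_fst | exact: dom_continuous].
  by apply: continuous_comp; [exact: cvg_snd | exact: rng_continuous].
have cUV := compact_setX cU cV.
have -> : sprod U V = (fun p => gmul p.1 p.2) @` ((U `*` V) `&` D).
  apply/seteqP; split => [_ [a [b [Ua Vb ab ->]]]|_ [[a b] [[/= Ua Vb] ab] <-]].
    by exists (a, b).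
  by exists a, b.
apply: continuous_compact.
  by apply: continuous_subspaceW (@gmul_continuous E) => p [].
exact: compact_closedI.
Qed.

Lemma open_dom U : open U -> open (dom @` U).
Proof.
move=> oU; rewrite openE => _ [a Ua <-].
have [s [cs sa ds]] := local_section etE a.
have nU : \forall y \near dom a, U (s y).
  by apply: cs; rewrite sa; exact: open_nbhs_nbhs.
by apply: filterS2 ds nU => y dy Uy; exists (s y).
Qed.

Lemma open_ginv U : open U -> open (@ginv E @^-1` U).
Proof. by move=> oU; move/continuousP : (@ginv_continuous E); apply. Qed.

Lemma image_ginv U : @ginv E @` U = ginv @^-1` U.
Proof.
apply/seteqP; split => [_ [a Ua <-]|a Ua]; first by rewrite /= ginvK.
by exists (ginv a) => //; rewrite ginvK.
Qed.

Lemma cpt_open_dom U : cpt_open U -> cpt_open (dom @` U).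
Proof.
move=> [oU cU]; split; first exact: open_dom.
apply: continuous_compact => //.
by apply: continuous_subspaceT; exact: dom_continuous.
Qed.

Lemma cpt_open_ginv U : cpt_open U -> cpt_open (@ginv E @` U).
Proof.
move=> [oU cU]; split; first by rewrite image_ginv; exact: open_ginv.
apply: continuous_compact => //.
by apply: continuous_subspaceT; exact: ginv_continuous.
Qed.

Lemma cpt_open_rng U : cpt_open U -> cpt_open (rng @` U).
Proof.
move=> /cpt_open_ginv/cpt_open_dom; congr cpt_open.
apply/seteqP; split => [_ [_ [a Ua <-] <-]|_ [a Ua <-]].
  by exists a => //; rewrite dom_inv.
by exists (ginv a); [exists a | rewrite dom_inv].
Qed.

Lemma cpt_open_idn K : cpt_open K -> cpt_open (@idn E @` K).
Proof.
move=> [oK cK]; split.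
  rewrite [X in open X](_ : _ = range idn `&` dom @^-1` K).
    apply: openI; first exact: open_range_idn.
    by move/continuousP : (@dom_continuous E); apply.
  apply/seteqP; split => [_ [x Kx <-]|_ [[x _ <-] /=]].
    by split; [exists x | rewrite /= dom_idn].
  by rewrite dom_idn => Kx; exists x.
apply: continuous_compact => //.
by apply: continuous_subspaceT; exact: idn_continuous.
Qed.

Lemma bisection_idn K : cpt_open K -> bisection (@idn E @` K).
Proof.
move=> cK; split; first exact: cpt_open_idn.
- by move=> _ _ /set_mem[x _ <-] /set_mem[y _ <-]; rewrite !dom_idn => ->.
- by move=> _ _ /set_mem[x _ <-] /set_mem[y _ <-]; rewrite !rng_idn => ->.
- by exists 1%g => _ [x _ <-]; rewrite deg_idn.
Qed.

Lemma bisection_ginv U : bisection U -> bisection (@ginv E @` U).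
Proof.
move=> [cU Ud Ur [g Ug]]; split; first exact: cpt_open_ginv.
- move=> _ _ /set_mem[x Ux <-] /set_mem[y Uy <-]; rewrite !dom_inv => /Ur -> //;
  by rewrite inE.
- move=> _ _ /set_mem[x Ux <-] /set_mem[y Uy <-]; rewrite !rng_inv => /Ud -> //;
  by rewrite inE.
- by exists (g^-1)%g => _ [x Ux <-]; rewrite deg_inv Ug.
Qed.

Lemma bisection_sprod U V : bisection U -> bisection V -> bisection (sprod U V).
Proof.
move=> [[oU cU] Ud Ur [g Ug]] [[oV cV] Vd Vr [h Vh]]; split.
- by split; [exact: open_sprod | exact: compact_sprod].
- move=> _ _ /set_mem[a [b [Ua Vb ab ->]]] /set_mem[c [d [Uc Vd' cd ->]]].
  rewrite !dom_mul// => /Vd; rewrite !inE => /(_ Vb Vd') bd; subst d.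
  by congr gmul; apply: Ud; rewrite ?inE// ab cd.
- move=> _ _ /set_mem[a [b [Ua Vb ab ->]]] /set_mem[c [d [Uc Vd' cd ->]]].
  rewrite !rng_mul// => /Ur; rewrite !inE => /(_ Ua Uc) ac; subst c.
  by congr gmul; apply: Vr; rewrite ?inE// -ab cd.
- by exists (g * h)%g => _ [a [b [Ua Vb ab ->]]]; rewrite degM// Ug// Vh.
Qed.

Lemma dom_locally_injective a : exists U, [/\ open U, U a & set_inj U (@dom E)].
Proof.
have [U [oU Ua _ _ [s [_ sK]]]] := etE a; exists U; split => //.
exact: can_in_inj sK.
Qed.

(** A local section through [a] carries a compact open neighbourhood of [dom a] onto the desired
    bisection. *)
Lemma bisection_nbhs a U : nbhs a U -> exists V, [/\ bisection V, V a & V `<=` U].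
Proof.
move=> nU; have [V [oV Va Vd]] := dom_locally_injective a.
have [W [oW Wa Wd]] := dom_locally_injective (ginv a).
have oWi := open_ginv oW.
have od : open [set b : arr E | deg b = deg a].
  have /continuousP := @deg_continuous _ E.
  by move=> /(_ [set (deg a : discrete_topology G)] (discrete_open _)).
(* Besides lying in [U], arrows of [O] are determined by their source (through [V]) and by their
   range (through [W], since [rng] is [dom] after inversion), and have constant degree. *)
pose O := (U° `&` V `&` (ginv @^-1` W) `&` [set b : arr E | deg b = deg a]).
have oO : open O by do !apply: openI => //; exact: open_interior.
have Oa : O a by do !split.
have [s [cs sa ds]] := local_section etE a.
have nO : \forall y \near dom a, O (s y).
  by apply: cs; rewrite sa; exact: open_nbhs_nbhs.
have [K [[oK cK] Ka KO]] := cpt_open_nbhs bX (filterI ds nO).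
have oB : open (O `&` dom @^-1` K).
  apply: openI => //; by move/continuousP : (@dom_continuous E); apply.
have Ed : {in O &, injective (@dom E)}.
  by apply: sub_in2 Vd => b; rewrite !inE => -[[[]]].
have cB : compact (O `&` dom @^-1` K).
  (* b |-> dom b is a homeomorphism of O `&` dom @^-1` K onto K *)
  move=> F FF FB.
  have FK : F (dom @^-1` K) by apply: filterS FB => b [].
  have [y [Ky cl]] := cK (dom @ F) (fmap_proper_filter dom FF) FK.
  have [dy Oy] := KO _ Ky.
  exists (s y); split; first by split => //=; rewrite dy.
  move=> A B FA nB.
  have [Z [oZ Zy Zd]] : exists Z, [/\ open Z, Z (s y) & Z `<=` B `&` O].
    exists (B° `&` O); split.
    - by apply: openI => //; exact: open_interior.
    - by split.
    - by move=> z [/interior_subset].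
  have nZ : nbhs y (dom @` Z).
    by apply: open_nbhs_nbhs; split; [exact: open_dom | exists (s y)].
  have FAB : F (dom @^-1` (dom @` (A `&` (O `&` dom @^-1` K)))).
    by apply: filterS (filterI FA FB) => b [Ab Bb]; exists b.
  have [_ [[b [Ab [Ob Kb]] <-] [z Zz zb]]] := cl _ _ FAB nZ.
  exists b; split => //.
  have [Bz Oz] := Zd _ Zz.
  by rewrite -(Ed z b) ?inE.
exists (O `&` dom @^-1` K); split.
- split.
  + by split.
  + by apply: sub_in2 Ed => b /set_mem[Ob _]; exact: mem_set.
  + move=> b c /set_mem[[[[_ _] Wb] _] _] /set_mem[[[[_ _] Wc] _] _] e.
    rewrite -(ginvK b) -(ginvK c); congr ginv.
    by apply: Wd; rewrite ?inE// !dom_inv.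
  + by exists (deg a) => b [[]].
- by split.
- by move=> b [[[[/interior_subset]]]].
Qed.

End EtaleGroupoid.

(** * Indicators and locally constant functions *)

Section Indicator.
Variables (R : nzRingType) (T : Type).
Implicit Types (U V : set T) (t : T).

Definition ind U : T -> R := fun t => (t \in U)%:R.

Lemma ind1 U t : U t -> ind U t = 1.
Proof. by move=> Ut; rewrite /ind mem_set. Qed.

Lemma ind0 U t : ~ U t -> ind U t = 0.
Proof. by move=> Ut; rewrite /ind memNset. Qed.

Lemma ind_neq0 U t : ind U t != 0 <-> U t.
Proof.
split => [|/ind1 ->]; last exact: oner_neq0.
by apply: contraPP => /ind0 ->; rewrite eqxx.
Qed.

Lemma eq_ind (f : T -> R) U :
  (forall t, U t -> f t = 1) -> (forall t, ~ U t -> f t = 0) -> f = ind U.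
Proof.
move=> f1 f0; apply/funext => t.
by have [Ut|nUt] := pselect (U t); [rewrite f1 ?ind1 | rewrite f0 ?ind0].
Qed.

Lemma indI U V t : ind (U `&` V) t = ind U t * ind V t.
Proof.
have [Ut|nUt] := pselect (U t); last by rewrite (ind0 nUt) mul0r ind0 => // -[].
have [Vt|nVt] := pselect (V t); first by rewrite !ind1 ?mulr1//; split.
by rewrite (ind0 nVt) mulr0 ind0 => // -[].
Qed.

Lemma indC U t : ind U t + ind (~` U) t = 1.
Proof.
have [Ut|nUt] := pselect (U t); first by rewrite ind1// ind0 ?addr0 => // /(_ Ut).
by rewrite ind0// ind1 ?add0r.
Qed.

End Indicator.

Section LocallyConstant.
Variables (R : comNzRingType) (E : topGroupoid).
Implicit Types f g : arr E -> R.

Lemma lc_open f (S : set R) : locally_constant f -> open (f @^-1` S).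
Proof.
by move=> lf; rewrite openE => a Sa; apply: filterS (lf a) => b /= ->.
Qed.

Lemma lc_supp_closed f : locally_constant f -> closed (supp f).
Proof.
move=> lf; rewrite -[supp f]setCK; apply: open_closedC.
exact: (@lc_open f (~` [set r | r != 0])).
Qed.

Lemma lc_supp_open f : locally_constant f -> open (supp f).
Proof. exact: (@lc_open f [set r | r != 0]). Qed.

Lemma algP f : groupoid_algebra f <-> locally_constant f /\ compact (supp f).
Proof.
rewrite /groupoid_algebra /=; split => -[lf];
  rewrite (_ : closure (supp f) = supp f) //;
  by apply/esym/closure_id; exact: lc_supp_closed.
Qed.

Lemma lc_add f g : locally_constant f -> locally_constant g ->
  locally_constant (f \+ g).
Proof.
by move=> lf lg a; apply: filterS2 (lf a) (lg a) => b /= -> ->.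
Qed.

Lemma lc_mul f g : locally_constant f -> locally_constant g ->
  locally_constant (fun a => f a * g a).
Proof.
by move=> lf lg a; apply: filterS2 (lf a) (lg a) => b /= -> ->.
Qed.

Lemma lc_ind (U : set (arr E)) : open U -> closed U -> locally_constant (ind R U).
Proof.
move=> oU cU a; have [Ua|nUa] := pselect (U a).
  rewrite (ind1 _ Ua).
  by apply: filterS (open_nbhs_nbhs (conj oU Ua)) => b Ub; rewrite ind1.
rewrite (ind0 _ nUa).
have nU : nbhs a (~` U) by apply: open_nbhs_nbhs; split => //; exact: closed_openC.
by apply: filterS nU => b Ub; rewrite ind0.
Qed.

Lemma alg0 : groupoid_algebra (fun _ : arr E => 0 : R).
Proof.
apply/algP; split; first by move=> a; exact: nearW.
rewrite (_ : supp _ = set0); first exact: compact0.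
by rewrite -subset0 => a; rewrite /supp /= eqxx.
Qed.

Lemma alg_mulr f g : groupoid_algebra f -> locally_constant g ->
  groupoid_algebra (fun a => f a * g a).
Proof.
move=> /algP[lf cf] lg; apply/algP; split; first exact: lc_mul.
apply: (subclosed_compact _ cf); first by apply: lc_supp_closed; exact: lc_mul.
by move=> a; rewrite /supp /=; apply: contra_neq => ->; rewrite mul0r.
Qed.

Lemma alg_add f g : groupoid_algebra f -> groupoid_algebra g ->
  groupoid_algebra (f \+ g).
Proof.
move=> /algP[lf cf] /algP[lg cg]; apply/algP; split; first exact: lc_add.
apply: (subclosed_compact _ (compactU cf cg)).
  by apply: lc_supp_closed; exact: lc_add.
move=> a; rewrite /supp /=; have [->|] := eqVneq (f a) 0; last by left.
by rewrite add0r; right.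
Qed.

Hypothesis hE : hausdorff_space (arr E).

Lemma alg_ind1 (U : set (arr E)) : cpt_open U -> groupoid_algebra (ind R U).
Proof.
move=> cU; apply/algP; split.
  by apply: lc_ind; [exact: cU.1 | exact: cpt_open_closed].
rewrite (_ : supp _ = U); first exact: cU.2.
by apply/seteqP; split => a; rewrite /supp /= => /ind_neq0.
Qed.

End LocallyConstant.

(** * Convolution and induction over the groupoid algebra *)

Section Convolution.
Variables (R : comNzRingType) (G : groupType) (E : gradedGroupoid G).
Implicit Types (f g : arr E -> R) (a b c : arr E).

Lemma conv_neq0 f g c : conv f g c != 0 ->
  exists a b, [/\ dom a = rng b, c = gmul a b, f a != 0 & g b != 0].
Proof.
move=> nz; apply: contrapT => nab; move/eqP: nz; apply.
apply: fsbig1 => b /= db.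
have [->|gb] := eqVneq (g b) 0; first by rewrite mulr0.
have [->|fa] := eqVneq (f (gmul c (ginv b))) 0; first by rewrite mul0r.
case: nab; exists (gmul c (ginv b)), b; split => //.
  by rewrite dom_mul ?dom_inv ?rng_inv.
by rewrite gmulKV.
Qed.

Lemma conv_single f g a b : dom a = rng b ->
  (forall b', dom b' = dom b ->
    f (gmul (gmul a b) (ginv b')) != 0 -> g b' != 0 -> b' = b) ->
  conv f g (gmul a b) = f a * g b.
Proof.
move=> ab u; rewrite /conv -(fsbig_widen [set b]).
- by rewrite fsbig_set1 gmulK.
- by move=> _ -> /=; rewrite dom_mul.
- move=> b' [/=]; rewrite dom_mul// => db nb.
  apply: contrapT => /eqP nz; apply: nb; apply: u => //.
    by apply: contra_neq nz => ->; rewrite mul0r.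
  by apply: contra_neq nz => ->; rewrite mulr0.
Qed.

Lemma conv_uniq_dom f g a b : dom a = rng b ->
  (forall b', g b' != 0 -> dom b' = dom b -> b' = b) ->
  conv f g (gmul a b) = f a * g b.
Proof. by move=> ab u; apply: conv_single => // b' db _ gb; exact: u. Qed.

Lemma conv_uniq_rng f g a b : dom a = rng b ->
  (forall a', f a' != 0 -> rng a' = rng a -> a' = a) ->
  conv f g (gmul a b) = f a * g b.
Proof.
move=> ab u; apply: conv_single => // b' db fz _.
have e : dom (gmul a b) = rng (ginv b') by rewrite dom_mul// rng_inv.
have := u _ fz; rewrite !rng_mul// => /(_ erefl) E1.
have e1 : dom (gmul a b) = dom b' by rewrite dom_mul.
have db' : dom a = rng b' by rewrite -{1}E1 dom_mul// dom_inv.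
by have := gmulKV e1; rewrite E1 => /(congr1 (gmul (ginv a))); rewrite !gmulVK.
Qed.

Lemma conv_diagl f g c : supp f `<=` range idn ->
  conv f g c = f (idn (rng c)) * g c.
Proof.
move=> df; rewrite -[in LHS](gmul_idl c); apply: conv_uniq_rng.
  by rewrite dom_idn.
by move=> a /df[x _ <-]; rewrite !rng_idn => ->.
Qed.

Lemma conv_diagr f g c : supp g `<=` range idn ->
  conv f g c = f c * g (idn (dom c)).
Proof.
move=> dg; rewrite -[in LHS](gmul_idr c); apply: conv_uniq_dom.
  by rewrite rng_idn.
by move=> a /dg[x _ <-]; rewrite !dom_idn => ->.
Qed.

Lemma supp_ind_idn K : supp (ind R (@idn E @` K)) `<=` range idn.
Proof. by move=> a /ind_neq0[x _ <-]; exists x. Qed.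

Lemma ind_idn K x : ind R (@idn E @` K) (idn x) = ind R K x.
Proof.
have [Kx|nKx] := pselect (K x); first by rewrite !ind1//; exists x.
rewrite !ind0// => -[y Ky] /(congr1 dom); rewrite !dom_idn => yx.
by apply: nKx; rewrite -yx.
Qed.

Lemma conv_idnl K f c : conv (ind R (idn @` K)) f c = ind R K (rng c) * f c.
Proof. by rewrite conv_diagl ?ind_idn//; exact: supp_ind_idn. Qed.

Lemma conv_idnr K f c : conv f (ind R (idn @` K)) c = f c * ind R K (dom c).
Proof. by rewrite conv_diagr ?ind_idn//; exact: supp_ind_idn. Qed.

Lemma conv_bisection (U V : set (arr E)) : bisection V ->
  conv (ind R U) (ind R V) = ind R (sprod U V).
Proof.
move=> [_ Vd _ _]; apply: eq_ind => c.
  move=> [a [b [Ua Vb ab ->]]]; rewrite conv_uniq_dom// ?ind1 ?mulr1//.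
  by move=> b' /ind_neq0 Vb'; apply: Vd; rewrite inE.
apply: contra_notP => /eqP/conv_neq0[a [b [ab -> /ind_neq0 Ua /ind_neq0 Vb]]].
by exists a, b.
Qed.

(** A sum with infinite support defaults to 0, so additivity may fail in general; finite fibres put
    all three sums over one finite set [S]. *)
Lemma conv_add f g h : (forall x, finite_set (supp g `&` dom @^-1` [set x])) ->
  (forall x, finite_set (supp h `&` dom @^-1` [set x])) ->
  conv f (g \+ h) = conv f g \+ conv f h.
Proof.
move=> fg fh; apply/funext => c /=.
pose S := (supp g `|` supp h) `&` dom @^-1` [set dom c].
have fS : finite_set S by rewrite /S setIUl finite_setU; split.
have W k : supp k `<=` supp g `|` supp h ->
    conv f k c = \sum_(a \in S) f (gmul c (ginv a)) * k a.
  move=> sk; rewrite /conv [RHS](fsbig_widen _ [set a | dom a = dom c])//.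
    by move=> a [].
  move=> a [/= da nS]; have [->|ka] := eqVneq (k a) 0; first by rewrite mulr0.
  by case: nS; split => //; exact: sk.
rewrite !W -?fsbig_split//.
- by apply: eq_fsbigr => a _; rewrite /= mulrDr.
- move=> a; rewrite /supp /=; have [->|] := eqVneq (g a) 0; last by left.
  by rewrite add0r; right.
Qed.

Hypothesis ampleE : ample E.
Hypothesis hE : hausdorff_space (arr E).

(** Locally such a function is a scalar multiple of the indicator of a bisection, and compactness of
    the support leaves finitely many pieces. *)
Lemma alg_ind (P : (arr E -> R) -> Prop) : P (fun=> 0) ->
  (forall f g, groupoid_algebra f -> groupoid_algebra g ->
     P f -> P g -> P (f \+ g)) ->
  (forall r U, bisection U -> P (fun a => r * ind R U a)) ->
  forall f, groupoid_algebra f -> P f.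
Proof.
move=> P0 PD PU f fA; have [lf cf] := (algP f).1 fA.
(* Asking for every clopen subset of [C] lets the union step split a clopen [Z] into its disjoint
   parts inside and outside [C]. *)
pose Q B := exists C, [/\ open C, closed C, B `<=` C &
  forall D, open D -> closed D -> D `<=` C -> P (fun a => f a * ind R D a)].
have [C [oC cC fC PC]] : Q (supp f).
  apply: (compact_ind cf).
  - exists set0; split => //; first exact: open0; first exact: closed0.
    move=> D _ _ D0; rewrite (_ : (fun a => _) = fun=> 0)//.
    by apply/funext => a; rewrite ind0 ?mulr0// => /D0.
  - move=> A B BA [C [oC cC AC PC]]; exists C; split => //.
    exact: subset_trans BA AC.
  - move=> A B [C [oC cC AC PC]] [D [oD cD BD PD']]; exists (C `|` D); split.
    + exact: openU.
    + exact: closedU.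
    + exact: setUSS.
    + move=> Z oZ cZ ZCD.
      rewrite (_ : (fun a => _) = (fun a => f a * ind R (Z `&` C) a) \+
          (fun a => f a * ind R (Z `&` ~` C) a)).
        have oC' := closed_openC cC; have cC' := open_closedC oC.
        apply: PD.
        * by apply: alg_mulr => //; apply: lc_ind; [exact: openI | exact: closedI].
        * by apply: alg_mulr => //; apply: lc_ind; [exact: openI | exact: closedI].
        * by apply: PC; [exact: openI | exact: closedI | move=> a []].
        * apply: PD'; [exact: openI | exact: closedI |].
          by move=> a [/ZCD []].
      by apply/funext => a /=; rewrite !indI -!mulrDr indC mulr1.
  - move=> a _; have [U [bU Ua Uf]] := bisection_nbhs ampleE (lf a).
    have [cU _ _ _] := bU.
    exists U; first exact: (open_nbhs_nbhs (conj cU.1 Ua)).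
    exists U; split => //; first exact: cU.1; first exact: cpt_open_closed.
    move=> D oD cD DU; rewrite (_ : (fun b => _) = fun b => f a * ind R D b).
      apply: PU; apply: (bisectionS bU _ DU).
      by rewrite -(setIidr DU); exact: cpt_openI.
    apply/funext => b; have [Db|nDb] := pselect (D b); last by rewrite ind0 ?mulr0.
    by rewrite (Uf b (DU _ Db)).
rewrite (_ : f = fun a => f a * ind R C a); first exact: PC.
apply/funext => a; have [->|fa] := eqVneq (f a) 0; first by rewrite mul0r.
by rewrite ind1 ?mulr1//; exact: fC.
Qed.

(** A bisection has at most one arrow over each source, and finiteness passes to sums. *)
Lemma finite_fibre f : groupoid_algebra f ->
  forall x, finite_set (supp f `&` dom @^-1` [set x]).
Proof.
move=> fA x; move: f fA; apply: alg_ind.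
- rewrite (_ : _ `&` _ = set0); first exact: finite_set0.
  by rewrite -subset0 => a []; rewrite /supp /= eqxx.
- move=> f g _ _ ff fg.
  apply: (@sub_finite_set _ _ ((supp f `&` dom @^-1` [set x]) `|`
    (supp g `&` dom @^-1` [set x]))); last by rewrite finite_setU.
  move=> a []; rewrite /supp /= => fga da.
  move: fga; have [->|] := eqVneq (f a) 0; last by left.
  by rewrite add0r; right.
- move=> r U [_ Ud _ _].
  have UF : forall a, (r * ind R U a) != 0 -> U a.
    by move=> a; apply: contraPP => nU; rewrite ind0// mulr0 eqxx.
  have [[a [Ua da]]|nU] := pselect (exists a, U a /\ dom a = x).
    apply: (@sub_finite_set _ _ [set a]); last exact: finite_set1.
    by move=> b [/UF Ub db]; apply: Ud; rewrite ?inE// da db.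
  rewrite (_ : _ `&` _ = set0); first exact: finite_set0.
  by rewrite -subset0 => a [/UF Ua da]; apply: nU; exists a.
Qed.

Lemma conv_closed f g : groupoid_algebra f -> groupoid_algebra g ->
  groupoid_algebra (conv f g).
Proof.
move=> fA gA.
have lc : locally_constant (conv f g).
  have [lf _] := (algP f).1 fA.
  move: g gA; apply: alg_ind.
  - rewrite (_ : conv f _ = fun=> 0); first by case: (alg0 R E).
    by apply/funext => c; apply: fsbig1 => a _; rewrite mulr0.
  - move=> g h gA hA lg lh; rewrite conv_add; first exact: lc_add.
      exact: finite_fibre.
    exact: finite_fibre.
  (* The sum has at most one term, at the arrow of [D] over [dom c]. If there is one, [near_factor]
     keeps it constant near [c]; if not, closedness of the set of sources of [D] keeps the value
     zero. *)
  - move=> r D [cD Dd _ _] c.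
    have UF : forall a, (r * ind R D a) != 0 -> D a.
      by move=> a; apply: contraPP => nU; rewrite ind0// mulr0 eqxx.
    have key c' b' : D b' -> dom b' = dom c' ->
        conv f (fun a => r * ind R D a) c' = f (gmul c' (ginv b')) * r.
      move=> Db db; rewrite -[in LHS](gmulKV (esym db)) conv_uniq_dom.
      + by rewrite ind1// mulr1.
      + by rewrite dom_mul ?dom_inv ?rng_inv.
      + by move=> a /UF Da; apply: Dd; rewrite inE.
    have [[b [Db db]]|nb] := pselect (exists b, D b /\ dom b = dom c).
      rewrite (key _ _ Db db).
      have e : dom (gmul c (ginv b)) = rng b by rewrite dom_mul ?dom_inv ?rng_inv.
      have := near_factor ampleE e (lf _) (open_nbhs_nbhs (conj cD.1 Db)).
      rewrite gmulKV//; apply: filterS => c' [b' [Db' db' fc]].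
      by rewrite (key _ _ Db' db') fc.
    have z c' : ~ (dom @` D) (dom c') -> conv f (fun a => r * ind R D a) c' = 0.
      move=> nD; apply: contrapT => /eqP/conv_neq0[a [b [ab E1 _ /UF Db]]].
      by apply: nD; exists b => //; rewrite E1 dom_mul.
    have nDc : ~ (dom @` D) (dom c) by move=> [b Db db]; apply: nb; exists b.
    rewrite (z _ nDc).
    have oD : open (dom @^-1` (~` (dom @` D)) : set (arr E)).
      move/continuousP : (@dom_continuous E); apply; apply: closed_openC.
      by apply: cpt_open_closed; [exact: ampleE.2.1 | exact: cpt_open_dom].
    by apply: filterS (open_nbhs_nbhs (conj oD nDc)) => c'; exact: z.
apply/algP; split => //.
have [[_ cf] [_ cg]] := ((algP f).1 fA, (algP g).1 gA).
apply: (subclosed_compact _ (compact_sprod ampleE cf cg)).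
  exact: lc_supp_closed.
by move=> c /conv_neq0[a [b [ab -> fa gb]]]; exists a, b.
Qed.

End Convolution.

(** * Groupoid isomorphisms induce algebra isomorphisms *)

Section FunctorPullback.
Variables (R : comNzRingType) (G : groupType).

Lemma farr_inv (E F : gradedGroupoid G) (phi : groupoidFunctor E F) a :
  farr phi (ginv a) = ginv (farr phi a).
Proof.
have e : dom a = rng (ginv a) by rewrite rng_inv.
have e' : dom (farr phi a) = rng (farr phi (ginv a)) by rewrite farr_dom farr_rng e.
rewrite -[LHS](gmulVK e') -farr_mul// gmulaV farr_idn -farr_rng.
by rewrite -dom_inv gmul_idr.
Qed.

(** Phrased on arrows only, so that exchanging the two functors is immediate and each pullback lemma
    serves both directions. *)
Definition inverse_functors (E F : gradedGroupoid G) (phi : groupoidFunctor E F)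
    (psi : groupoidFunctor F E) :=
  [/\ continuous (farr phi), continuous (farr psi),
      cancel (farr phi) (farr psi), cancel (farr psi) (farr phi) &
      forall a, deg (farr phi a) = deg a].

Lemma inverse_functorsC (E F : gradedGroupoid G) (phi : groupoidFunctor E F)
    (psi : groupoidFunctor F E) :
  inverse_functors phi psi -> inverse_functors psi phi.
Proof. by move=> [cp cq pq qp dp]; split => // b; rewrite -dp qp. Qed.

Section Pullback.
Variables (E F : gradedGroupoid G).
Variables (phi : groupoidFunctor E F) (psi : groupoidFunctor F E).
Hypothesis pq : inverse_functors phi psi.
Implicit Types f g : arr E -> R.

Lemma pullback_alg f : groupoid_algebra f -> groupoid_algebra (f \o farr psi)%FUN.
Proof.
have [cp cq pK qK _] := pq => /algP[lf cf]; apply/algP; split.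
  by move=> b; exact: (cq b _ (lf _)).
rewrite (_ : supp _ = farr phi @` supp f).
  by apply: continuous_compact => //; exact: continuous_subspaceT.
apply/seteqP; split => [b fb|_ [a fa <-]]; last by rewrite /supp /= pK.
by exists (farr psi b).
Qed.

Lemma pullback_diagonal f : Defs.diagonal f -> Defs.diagonal (f \o farr psi)%FUN.
Proof.
have [cp cq pK qK _] := pq => -[fA df]; split; first exact: pullback_alg.
move=> b /df[x _ xb]; exists (fobj phi x) => //.
by rewrite -farr_idn xb qK.
Qed.

Lemma pullback_homogeneous (g : G) f :
  homogeneous g f -> homogeneous g (f \o farr psi)%FUN.
Proof.
have [cp cq pK qK dp] := pq => -[fA df]; split; first exact: pullback_alg.
by move=> b /df /=; rewrite -dp qK.
Qed.

Lemma pullback_conv f g :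
  (conv f g \o farr psi)%FUN = conv (f \o farr psi)%FUN (g \o farr psi)%FUN.
Proof.
have [cp cq pK qK _] := pq; apply/funext => c /=; rewrite /conv.
rewrite (reindex_fsbig (farr psi) [set a | dom a = dom c]).
  apply: eq_fsbigr => a; rewrite inE /= => da.
  by rewrite farr_mul ?farr_inv// rng_inv.
split.
- by move=> a /= da; rewrite !farr_dom da.
- by move=> a b _ _; exact: (can_inj qK).
- move=> b /= db; exists (farr phi b) => //=.
  by rewrite farr_dom db -farr_dom qK.
Qed.

End Pullback.

Lemma iso_algebra_iso (E F : gradedGroupoid G) (phi : groupoidFunctor E F) :
  graded_groupoid_iso phi ->
  exists Phi : (arr E -> R) -> (arr F -> R),
    [/\ algebra_iso Phi, diagonal_preserving Phi & graded_map Phi].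
Proof.
move=> [[[_ cp] [psi [[_ cq] _ _ pK qK]]] dp].
have pq : inverse_functors phi psi by [].
have qp := inverse_functorsC pq.
have K (g : arr F -> R) : ((g \o farr phi) \o farr psi)%FUN = g.
  by apply/funext => b /=; rewrite qK.
exists (fun f : arr E -> R => f \o farr psi)%FUN; split.
- split; last by [].
  split; last 2 first.
  + by [].
  + by move=> f g _ _; exact: pullback_conv.
  split.
  + by move=> f fA; exact: (pullback_alg pq).
  + move=> f g _ _ /(congr1 (fun h : arr F -> R => h \o farr phi)%FUN) e.
    apply/funext => a.
    by have := congr1 (@^~ a) e; rewrite /= pK.
  + move=> g gA; exists (g \o farr phi)%FUN => //; exact: (pullback_alg qp).
- apply/seteqP; split => [_ [f fA <-]|g gA].
    exact: (pullback_diagonal pq).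
  by exists (g \o farr phi)%FUN => //; exact: (pullback_diagonal qp).
- move=> h; apply/seteqP; split => [_ [f fA <-]|g gA].
    exact: (pullback_homogeneous pq).
  by exists (g \o farr phi)%FUN => //; exact: (pullback_homogeneous qp).
Qed.

End FunctorPullback.

(** * Diagonal-preserving graded homomorphisms and their inverses *)

Section GradedHom.
Variables (R : comNzRingType) (G : groupType).

(** Scalars are absent because the maps come from ring isomorphisms. Inclusions replace equalities
    of images: the record will hold for a map and for its inverse. *)
Record diag_graded_hom (E F : gradedGroupoid G) (Phi : (arr E -> R) -> (arr F -> R))
    : Prop := {
  hom_alg : forall f, groupoid_algebra f -> groupoid_algebra (Phi f);
  hom_add : forall f g, groupoid_algebra f -> groupoid_algebra g ->
    Phi (f \+ g) = Phi f \+ Phi g;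
  hom_conv : forall f g, groupoid_algebra f -> groupoid_algebra g ->
    Phi (conv f g) = conv (Phi f) (Phi g);
  hom_diag : forall f, Defs.diagonal f -> Defs.diagonal (Phi f);
  hom_deg : forall (g : G) f, homogeneous g f -> homogeneous g (Phi f)
}.

Lemma ring_iso_inverse (E F : gradedGroupoid G) (Phi : (arr E -> R) -> (arr F -> R)) :
  ample E -> hausdorff_space (arr E) ->
  ring_iso Phi -> diagonal_preserving Phi -> graded_map Phi ->
  exists Psi : (arr F -> R) -> (arr E -> R),
    [/\ diag_graded_hom Phi, diag_graded_hom Psi,
        forall f, groupoid_algebra f -> Psi (Phi f) = f &
        forall g, groupoid_algebra g -> Phi (Psi g) = g].
Proof.
move=> aE hE [[Pf Pi Ps] Pa Pc] Pd Pg.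
have /choice[Psi PsiP] : forall g : arr F -> R, exists f : arr E -> R,
    groupoid_algebra g -> groupoid_algebra f /\ Phi f = g.
  move=> g; have [gA|ngA] := pselect (groupoid_algebra g); last by exists (fun=> 0).
  by have [f fA fg] := Ps g gA; exists f.
have PsiA g gA : groupoid_algebra (Psi g) := (PsiP g gA).1.
have PhiK g gA : Phi (Psi g) = g := (PsiP g gA).2.
have Pa' f g : groupoid_algebra f -> groupoid_algebra g ->
    Phi (f \+ g) = Phi f \+ Phi g.
  by move=> fA gA; apply: Pa; rewrite inE.
have Pc' f g : groupoid_algebra f -> groupoid_algebra g ->
    Phi (conv f g) = conv (Phi f) (Phi g).
  by move=> fA gA; apply: Pc; rewrite inE.
have PsiK f : groupoid_algebra f -> Psi (Phi f) = f.
  move=> fA; have gA := Pf _ fA.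
  by apply: Pi; rewrite ?inE ?PhiK//; exact: PsiA.
exists Psi; split => //; split => //.
- by move=> f fA; rewrite -Pd; exists f.
- by move=> g f fA; rewrite -Pg; exists f.
- move=> f g fA gA; rewrite -{1}(PhiK f)// -{1}(PhiK g)// -Pa' ?PsiK//;
    try exact: PsiA.
  by apply: alg_add; exact: PsiA.
- move=> f g fA gA; rewrite -{1}(PhiK f)// -{1}(PhiK g)// -Pc' ?PsiK//;
    try exact: PsiA.
  by apply: conv_closed => //; exact: PsiA.
- by move=> g; rewrite -Pd => -[f fd <-]; rewrite PsiK//; exact: fd.1.
- by move=> h g; rewrite -Pg => -[f fd <-]; rewrite PsiK//; exact: fd.1.
Qed.

End GradedHom.

(** * Units of the group rings of the isotropy groups *)

Lemma fsbig_reindex_supp (R : nmodType) (I J : choiceType) (e : I -> J) (S : set J)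
    (F : J -> R) :
  injective e -> (forall i, S (e i)) ->
  (forall j, S j -> F j != 0 -> exists i, e i = j) ->
  \sum_(j \in S) F j = \sum_(i \in [set: I]) F (e i).
Proof.
move=> ei eS eF; rewrite -(fsbig_widen (range e)).
- apply: reindex_fsbig; split => [i _|i j _ _|_ [i _ <-]]; first by exists i.
  + exact: ei.
  + by exists i.
- by move=> _ [i _ <-].
- move=> j [Sj nj] /=; apply: contrapT => /eqP/(eF _ Sj)[i ij].
  by apply: nj; exists i.
Qed.

Section IsotropyUnits.
Variables (R : comNzRingType) (G : groupType) (E : gradedGroupoid G).
Variables (ampleE : ample E) (hE : hausdorff_space (arr E)).
Implicit Types (f g : arr E -> R) (a b c : arr E).

Let etE : etale E := ampleE.1.

Lemma isotropy_group_val x a : int_isotropy1 a -> dom a = x ->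
  exists h : isotropy_group etE x, val h = a.
Proof.
move=> ia da.
have Ha : a \in isotropy_set x by rewrite inE.
by exists (SigSub Ha).
Qed.

(* [k |-> f (a * k)] is a unit of the group ring of the isotropy group at [x],
   with inverse [k |-> f' (k * a^-1)]; hence it is supported at one point. *)
Lemma unit_fibre f f' K L x :
  groupoid_algebra f -> groupoid_algebra f' ->
  (forall a b, f' a != 0 -> f b != 0 -> dom a = rng b -> isotropy1 (gmul a b)) ->
  (forall a b, f a != 0 -> f b != 0 -> rng a = rng b ->
     isotropy1 (gmul (ginv a) b)) ->
  (forall a b, f a != 0 -> f b != 0 -> dom a = dom b -> rng a = rng b) ->
  (forall a, f a != 0 -> K (rng a) /\ L (dom a)) ->
  conv f f' = ind R (idn @` K) -> conv f' f = ind R (idn @` L) ->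
  no_nontrivial_units R (isotropy_group etE x) ->
  forall a b, f a != 0 -> f b != 0 -> dom a = x -> dom b = x -> a = b.
Proof.
move=> fA fA' iso' iso dr KL eK eL nu a b fa fb da db.
have rab : rng a = rng b by apply: dr => //; rewrite da db.
have [[lf _] [lf' _]] := ((algP f).1 fA, (algP f').1 fA').
(* Products of the open supports are open and consist of isotropy arrows of degree 1, so they lie in
   the interior; this places them in the isotropy group. *)
have int' c d : f' c != 0 -> f d != 0 -> dom c = rng d -> int_isotropy1 (gmul c d).
  move=> fc fd cd; have oS : open (sprod (supp f') (supp f)).
    by apply: open_sprod => //; exact: lc_supp_open.
  have : sprod (supp f') (supp f) `<=` @isotropy1 G E.
    by move=> _ [c' [d' [? ? ? ->]]]; exact: iso'.
  by rewrite open_subsetE//; apply; exists c, d.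
have int c d : f c != 0 -> f d != 0 -> rng c = rng d ->
    int_isotropy1 (gmul (ginv c) d).
  move=> fc fd cd; have oS : open (sprod (ginv @^-1` supp f) (supp f)).
    apply: open_sprod => //; last exact: lc_supp_open.
    by apply: open_ginv; exact: lc_supp_open.
  have : sprod (ginv @^-1` supp f) (supp f) `<=` @isotropy1 G E.
    move=> _ [c' [d' [? ? ? ->]]]; rewrite -(ginvK c'); apply: iso => //.
    by rewrite rng_inv.
  rewrite open_subsetE//; apply; exists (ginv c), d; split => //=.
    by rewrite ginvK.
  by rewrite dom_inv.
pose H := isotropy_group etE x.
have vd (h : H) : dom (val h) = x by have [] := isoP h.
have vr (h : H) : rng (val h) = x by have [] := isoP h.
have vV (h : H) : val (h^-1)%g = ginv (val h) by [].
have vM (h k : H) : val (h * k)%g = gmul (val h) (val k) by [].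
have v1 : val (1%g : H) = idn x by [].
pose u : H -> R := fun k => f (gmul a (val k)).
pose v : H -> R := fun k => f' (gmul (val k) (ginv a)).
have dak (k : H) : dom a = rng (val k) by rewrite vr.
have dka (k : H) : dom (val k) = rng (ginv a) by rewrite rng_inv vd.
have injl : injective (fun k : H => gmul a (val k)).
  by move=> k l /(congr1 (gmul (ginv a))); rewrite !gmulVK// => /val_inj.
have injr : injective (fun k : H => gmul (val k) (ginv a)).
  move=> k l /(congr1 (fun c => gmul c (ginv (ginv a)))).
  by rewrite !gmulK// => /val_inj.
have fu : group_ring u.
  apply: (@sub_finite_set _ _ ((fun k : H => gmul a (val k)) @^-1`
    (supp f `&` dom @^-1` [set x]))).
    by move=> k uk; split; [exact: uk | exact: (etrans (dom_mul (dak k)) (vd k))].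
  apply: finite_preimage; first by move=> k l _ _; exact: injl.
  exact: finite_fibre.
have fv : group_ring v.
  apply: (@sub_finite_set _ _ ((fun k : H => gmul (val k) (ginv a)) @^-1`
    (supp f' `&` dom @^-1` [set rng a]))).
    move=> k uk; split; first exact: uk.
    exact: (etrans (dom_mul (dka k)) (dom_inv a)).
  apply: finite_preimage; first by move=> k l _ _; exact: injr.
  exact: finite_fibre.
have [Kra] := KL _ fa; rewrite da => Lx.
have uv : gr_mul u v = gr_monomial 1 1%g.
  (* Conjugation by [a] moves [h] to the object [rng a]; the substitution [d = k a^-1] turns the
     convolution at [c] into the group ring product at [h]. *)
  apply/funext => h; pose c := gmul (gmul a (val h)) (ginv a).
  have dah : dom (gmul a (val h)) = rng (ginv a) by rewrite dom_mul// rng_inv vd.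
  have dc : dom c = rng a by rewrite /c dom_mul// dom_inv.
  transitivity (conv f f' c).
    rewrite /conv (fsbig_reindex_supp injr).
    - apply: eq_fsbigr => k _; rewrite /u /v vM vV.
      have hk : dom (val h) = rng (ginv (val k)) by rewrite rng_inv !vd.
      have ak : dom a = rng (ginv (val k)) by rewrite rng_inv vd.
      congr (f _ * _); rewrite ginvM// ginvK (gmulA dc ak) (gmulA (dak h) hk).
      by rewrite gmulKV// dom_mul// vd.
    - by move=> k; exact: (etrans (dom_mul (dka k)) (etrans (dom_inv a) (esym dc))).
    - move=> d /= dd nz.
      have fd' : f' d != 0 by apply: contra_neq nz => ->; rewrite mulr0.
      have dda : dom d = rng a by rewrite dd dc.
      have [k kE] := isotropy_group_val (int' _ _ fd' fa dda)
        (etrans (dom_mul dda) da).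
      by exists k; rewrite kE gmulK.
  rewrite eK /gr_monomial; have [hE1|h1] := eqVneq h 1%g.
    rewrite ind1//; exists (rng a) => //.
    by rewrite /c hE1 v1 -da gmul_idr gmulaV.
  rewrite ind0// => -[y _ yc]; case/eqP: h1; apply: val_inj; rewrite v1.
  have := gmulKV (etrans dah (rng_inv a)); rewrite -/c -yc.
  have -> : y = rng a by rewrite -(dom_idn y) yc dc.
  by rewrite gmul_idl => /(congr1 (gmul (ginv a))); rewrite gmulVK// gmulVa da.
have vu : gr_mul v u = gr_monomial 1 1%g.
  apply/funext => h.
  (* Here the substitution is [d = a k]; it reaches every [d] of the support over [x] because [dr]
     gives them all the range of [a]. *)
  transitivity (conv f' f (val h)).
    rewrite /conv (fsbig_reindex_supp injl).
    - apply: eq_fsbigr => k _; rewrite /u /v vM vV.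
      congr (f' _ * _).
      by rewrite ginvM// gmulA// ?rng_inv ?vd// dom_inv vr -da.
    - by move=> k; exact: (etrans (dom_mul (dak k)) (etrans (vd k) (esym (vd h)))).
    - move=> d /= dd nz.
      have fd : f d != 0 by apply: contra_neq nz => ->; rewrite mulr0.
      have fd' : f' (gmul (val h) (ginv d)) != 0.
        by apply: contra_neq nz => ->; rewrite mul0r.
      have rd : rng a = rng d by apply: dr; rewrite // da dd vd.
      have [k kE] := isotropy_group_val (int _ _ fa fd rd)
        (etrans (dom_mul (etrans (dom_inv a) rd)) (etrans dd (vd h))).
      by exists k; rewrite kE gmulVKr.
  rewrite eL /gr_monomial; have [hE1|h1] := eqVneq h 1%g.
    by rewrite hE1 ind1//; exists x.
  rewrite ind0// => -[y _ yc]; case/eqP: h1; apply: val_inj; rewrite v1 -yc.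
  by rewrite -(vd h) -yc dom_idn.
have : gr_units u by split => //; exists v.
rewrite nu => -[r [h [_ uE]]].
(* [u] is non-zero at the identity, where its value is [f a], so the monomial sits there; [b] is [a]
   times a point of the support of [u]. *)
have u0 k : u k != 0 -> k = h.
  by rewrite uE /gr_monomial; case: (k =P h) => // _; rewrite eqxx.
have h1 : h = 1%g by apply/esym/u0; rewrite /u v1 -da gmul_idr.
have [k kE] := isotropy_group_val (int _ _ fa fb rab)
  (etrans (dom_mul (etrans (dom_inv a) rab)) db).
have : k = h by apply: u0; rewrite /u kE gmulVKr.
move=> /(congr1 val); rewrite kE h1 v1 => /(congr1 (gmul a)).
by rewrite gmulVKr// -da gmul_idr.
Qed.

End IsotropyUnits.

(** * The correspondence of objects *)

Lemma cpt_open_separate (X : topologicalType) (x y : X) : boolean_space X ->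
  (forall K, cpt_open K -> K x -> K y) -> x = y.
Proof.
move=> bX xy; apply: contrapT => /eqP nxy.
have := bX.1; rewrite open_hausdorff => /(_ _ _ nxy).
move=> [[A B] /= [/set_mem Ax /set_mem By] [oA oB /eqP AB]].
have [K [cK Kx KA]] := cpt_open_nbhs bX (open_nbhs_nbhs (conj oA Ax)).
by move: AB; rewrite -subset0 => /(_ y); apply; split => //; apply: KA; exact: xy.
Qed.

Section Hat.
Variables (R : comNzRingType) (G : groupType) (E F : gradedGroupoid G).
Variables (Psi : (arr F -> R) -> (arr E -> R)).
Hypothesis indecR : indecomposable R.
Hypotheses (ampleE : ample E) (hE : hausdorff_space (arr E)).
Hypotheses (ampleF : ample F) (hF : hausdorff_space (arr F)).
Hypothesis hPsi : diag_graded_hom Psi.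
Implicit Types K : set (obj F).

(* The compact open set [hat K] satisfies [Psi 1_K = 1_(hat K)]. *)
Definition hat K : set (obj E) := [set x | Psi (ind R (@idn F @` K)) (idn x) != 0].

Let indA K : cpt_open K -> groupoid_algebra (ind R (@idn F @` K)).
Proof. by move=> cK; apply: alg_ind1 => //; exact: cpt_open_idn. Qed.

Lemma hom0 : Psi (fun=> 0) = fun=> 0.
Proof.
have a0 := alg0 R F; have := hom_add hPsi a0 a0.
rewrite (_ : _ \+ _ = fun=> 0); last by apply/funext => a /=; rewrite addr0.
move=> e; apply/funext => a; have := congr1 (@^~ a) e => /= /esym/eqP.
by rewrite -[X in _ == X]addr0 (inj_eq (addrI _)) => /eqP.
Qed.

(* By indecomposability the idempotents of the diagonal are indicators. *)
Lemma hom_idn K : cpt_open K -> Psi (ind R (idn @` K)) = ind R (idn @` hat K).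
Proof.
move=> cK; have [fA df] : Defs.diagonal (Psi (ind R (idn @` K))).
  by apply: (hom_diag hPsi); split; [exact: indA | exact: supp_ind_idn].
set f := Psi _ in fA df *.
have ff : conv f f = f.
  rewrite -(hom_conv hPsi); [|exact: indA|exact: indA]; congr Psi.
  apply/funext => c; rewrite conv_idnr.
  have [[x Kx <-]|nc] := pselect ((@idn F @` K) c); last by rewrite ind0 ?mul0r.
  by rewrite dom_idn (ind1 _ Kx) mulr1.
apply: eq_ind => [_ [x fx <-]|c nc].
  have := congr1 (@^~ (idn x)) ff; rewrite /= conv_diagl// rng_idn => /indecR[f0|//].
  by move/eqP : fx; rewrite -/f f0.
apply: contrapT => /eqP fc; apply: nc; have [x _ xc] := df c fc.
by exists x => //; rewrite /hat /= xc.
Qed.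

Lemma cpt_open_hat K : cpt_open K -> cpt_open (hat K).
Proof.
move=> cK; have : Defs.diagonal (Psi (ind R (idn @` K))).
  by apply: (hom_diag hPsi); split; [exact: indA | exact: supp_ind_idn].
move=> [/algP[lf cf] df].
rewrite (_ : hat K = dom @` supp (Psi (ind R (idn @` K)))).
  by apply: cpt_open_dom => //; split => //; exact: lc_supp_open.
apply/seteqP; split => [x fx|_ [a fa <-]].
  by exists (idn x) => //; rewrite dom_idn.
by have [x _ xa] := df a fa; rewrite /hat /= -xa dom_idn xa.
Qed.

Lemma hat0 : hat set0 = set0.
Proof.
rewrite -subset0 => x; rewrite /hat /= image_set0.
rewrite (_ : ind R set0 = fun=> 0) ?hom0 ?eqxx//.
by apply/esym/eq_ind.
Qed.

(** An intersection is a convolution product of diagonal indicators, so multiplicativity of [Psi]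
    suffices. *)
Lemma hatI K L : cpt_open K -> cpt_open L -> hat (K `&` L) = hat K `&` hat L.
Proof.
move=> cK cL.
have cKL : cpt_open (K `&` L) by apply: cpt_openII => //; exact: ampleF.2.1.
have e : ind R (@idn E @` hat (K `&` L)) =
    conv (ind R (idn @` hat K)) (ind R (idn @` hat L)).
  rewrite -!hom_idn// -(hom_conv hPsi); [|exact: indA|exact: indA]; congr Psi.
  apply/esym/eq_ind => [_ [x [Kx Lx] <-]|c nc]; rewrite conv_idnr.
    by rewrite dom_idn !ind1 ?mulr1//; exists x.
  have [[x Kx xc]|nKc] := pselect ((@idn F @` K) c); last by rewrite ind0 ?mul0r.
  rewrite mulrC ind0 ?mul0r// => Lc; apply: nc; exists x => //; split => //.
  by move: Lc; rewrite -xc dom_idn.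
apply/seteqP; split => x.
- move=> Kx; have := congr1 (@^~ (idn x)) e.
  rewrite /= conv_idnr dom_idn ind_idn ind_idn ind1//.
  move=> /esym/eqP; have [Kx'|nKx] := pselect (hat K x); last first.
    by rewrite ind0// mul0r eq_sym oner_eq0.
  have [//|nLx] := pselect (hat L x).
  by rewrite (ind0 _ nLx) mulr0 eq_sym oner_eq0.
- move=> [Kx Lx]; have := congr1 (@^~ (idn x)) e.
  rewrite /= conv_idnr dom_idn !ind_idn (ind1 _ Kx) (ind1 _ Lx) mulr1 => e1.
  by apply/(ind_neq0 R); rewrite e1 oner_neq0.
Qed.

End Hat.

Section HatInverse.
Variables (R : comNzRingType) (G : groupType) (E F : gradedGroupoid G).
Variables (Psi : (arr F -> R) -> (arr E -> R)).
Variables (Phi : (arr E -> R) -> (arr F -> R)).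
Hypothesis indecR : indecomposable R.
Hypotheses (ampleE : ample E) (ampleF : ample F) (hF : hausdorff_space (arr F)).
Hypothesis hPsi : diag_graded_hom Psi.
Hypothesis PsiK : forall f, groupoid_algebra f -> Phi (Psi f) = f.

Lemma hatK K : cpt_open K -> hat Phi (hat Psi K) = K.
Proof.
move=> cK; have cK' := cpt_open_hat ampleE ampleF hF hPsi cK.
apply/seteqP; split => y; rewrite /hat /=.
  rewrite -(hom_idn indecR ampleF hF hPsi cK) PsiK; last first.
    by apply: alg_ind1 => //; exact: cpt_open_idn.
  by rewrite ind_idn => /ind_neq0.
rewrite -(hom_idn indecR ampleF hF hPsi cK) PsiK; last first.
  by apply: alg_ind1 => //; exact: cpt_open_idn.
by rewrite ind_idn => /(ind_neq0 R).
Qed.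

End HatInverse.

Section Points.
Variables (R : comNzRingType) (G : groupType) (E F : gradedGroupoid G).
Variables (Psi : (arr F -> R) -> (arr E -> R)).
Variables (Phi : (arr E -> R) -> (arr F -> R)).
Hypothesis indecR : indecomposable R.
Hypotheses (ampleE : ample E) (hE : hausdorff_space (arr E)).
Hypotheses (ampleF : ample F) (hF : hausdorff_space (arr F)).
Hypotheses (hPsi : diag_graded_hom Psi) (hPhi : diag_graded_hom Phi).
Hypothesis PhiK : forall f, groupoid_algebra f -> Psi (Phi f) = f.
Hypothesis PsiK : forall f, groupoid_algebra f -> Phi (Psi f) = f.

(** The homeomorphism of object spaces is kept as a relation, which can be read from either side and
    is turned into functions only at the end. *)
Definition point_rel (y : obj F) (x : obj E) :=
  forall K, cpt_open K -> (K y <-> hat Psi K x).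

Lemma pt_surj x : exists y, point_rel y x.
Proof.
have cT K (cK : cpt_open K) := cpt_open_hat ampleE ampleF hF hPsi cK.
have KK K (cK : cpt_open K) := hatK indecR ampleE ampleF hF hPsi PsiK cK.
apply: (boolean_correspondence ampleE.2 ampleF.2).
- exact: cT.
- move=> L cL; exists (hat Phi L).
    exact: (cpt_open_hat ampleF ampleE hE hPhi).
  exact: (hatK indecR ampleF ampleE hE hPhi PhiK).
- move=> K cK K0; rewrite -(KK K cK) K0; exact: (hat0 hPhi).
- exact: (hat0 hPsi).
- by move=> K L; exact: (hatI indecR ampleF hF hPsi).
Qed.

End Points.

(** * The correspondence of arrows *)

Section Reconstruction.
Variables (R : comNzRingType) (G : groupType) (E F : gradedGroupoid G).
Variables (Psi : (arr F -> R) -> (arr E -> R)).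
Variables (Phi : (arr E -> R) -> (arr F -> R)).
Hypothesis indecR : indecomposable R.
Hypotheses (ampleE : ample E) (hE : hausdorff_space (arr E)).
Hypotheses (ampleF : ample F) (hF : hausdorff_space (arr F)).
Hypotheses (hPsi : diag_graded_hom Psi) (hPhi : diag_graded_hom Phi).
Hypothesis PhiK : forall f, groupoid_algebra f -> Psi (Phi f) = f.
Hypothesis PsiK : forall f, groupoid_algebra f -> Phi (Psi f) = f.
Hypothesis units_dense : dense (fun x : obj E =>
  no_nontrivial_units R (isotropy_group (proj1 ampleE) x)).
Implicit Types (a b : arr F) (c d : arr E) (U V : set (arr F)).
Implicit Types (y : obj F) (x : obj E).

Local Notation pt := (point_rel Psi).
Local Notation hatPhi := (hat Phi).
Local Notation hat := (hat Psi).
Local Notation f_ U := (Psi (ind R U)).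

Let surj := pt_surj indecR ampleE hE ampleF hF hPsi hPhi PhiK PsiK.
Let cpt_hat := cpt_open_hat ampleE ampleF hF hPsi.
Let psi_idn := hom_idn indecR ampleF hF hPsi.

(** Each compact open [L] is the [hat] of [hatPhi L], so compact open sets around [y] decide
    membership of [x] in [L]. *)
Lemma ptC y x : pt y x -> point_rel Phi x y.
Proof.
move=> yx L cL.
rewrite -{1}(hatK indecR ampleF ampleE hE hPhi PhiK cL).
apply: iff_sym; apply: yx; exact: (cpt_open_hat ampleF ampleE hE hPhi).
Qed.

Lemma pt_total y : exists x, pt y x.
Proof.
have [x xy] := pt_surj indecR ampleF hF ampleE hE hPhi hPsi PsiK PhiK y.
exists x => K cK; rewrite -{1}(hatK indecR ampleE ampleF hF hPsi PsiK cK).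
by apply: iff_sym; apply: xy; exact: cpt_hat.
Qed.

Lemma pt_inj y y' x : pt y x -> pt y' x -> y = y'.
Proof.
move=> p p'; apply: (cpt_open_separate ampleF.2) => K cK.
by move=> /(p K cK)/(p' K cK).
Qed.

Lemma pt_fun y x x' : pt y x -> pt y x' -> x = x'.
Proof.
move=> yx yx'; have [p p'] := (ptC yx, ptC yx').
apply: (cpt_open_separate ampleE.2) => K cK.
by move=> /(p K cK)/(p' K cK).
Qed.

Lemma bisection_alg (X : gradedGroupoid G) (V : set (arr X)) :
  hausdorff_space (arr X) -> bisection V -> groupoid_algebra (ind R V).
Proof. by move=> hX [cV _ _ _]; exact: alg_ind1. Qed.

Let algU U : bisection U -> groupoid_algebra (ind R U) := bisection_alg hF.

Lemma alg_idn K : cpt_open K -> groupoid_algebra (ind R (@idn F @` K)).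
Proof. by move=> cK; apply: algU; exact: bisection_idn. Qed.

Lemma psi_idnr g K c : groupoid_algebra g -> cpt_open K ->
  Psi (conv g (ind R (idn @` K))) c = Psi g c * ind R (hat K) (dom c).
Proof.
move=> gA cK; rewrite (hom_conv hPsi)//; last exact: alg_idn.
by rewrite psi_idn// conv_idnr.
Qed.

Lemma psi_idnl g K c : groupoid_algebra g -> cpt_open K ->
  Psi (conv (ind R (idn @` K)) g) c = ind R (hat K) (rng c) * Psi g c.
Proof.
move=> gA cK; rewrite (hom_conv hPsi)//; last exact: alg_idn.
by rewrite psi_idn// conv_idnl.
Qed.

Lemma psi_restrict U K c : bisection U -> cpt_open K ->
  f_ (U `&` dom @^-1` K) c = f_ U c * ind R (hat K) (dom c).
Proof.
move=> bU cK; rewrite -psi_idnr//; last exact: algU.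
by congr (Psi _ c); apply/funext => a; rewrite indI conv_idnr.
Qed.

Lemma bisection_dom U : bisection U -> cpt_open (dom @` U).
Proof. by case=> cU _ _ _; exact: cpt_open_dom. Qed.

Lemma bisection_rng U : bisection U -> cpt_open (rng @` U).
Proof. by case=> cU _ _ _; exact: cpt_open_rng. Qed.

Lemma supp_hat_dom U c : bisection U -> f_ U c != 0 -> hat (dom @` U) (dom c).
Proof.
move=> bU; have -> : U = U `&` dom @^-1` (dom @` U).
  by apply/esym/setIidl => a Ua; exists a.
rewrite psi_restrict//; last exact: bisection_dom.
rewrite (_ : U `&` _ = U); last by apply/setIidl => a Ua; exists a.
by move=> nz; apply/(ind_neq0 R); apply: contra_neq nz => ->; rewrite mulr0.
Qed.

(* The function [f_ U] normalizes the diagonal, and the partial homeomorphism of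
   the object space it induces is the one induced by [U]. *)
Lemma supp_pt U c : bisection U -> f_ U c != 0 ->
  exists a, [/\ U a, pt (dom a) (dom c) & pt (rng a) (rng c)].
Proof.
move=> bU fc; have [y yc] := surj (dom c).
have [a Ua ay] := (yc _ (bisection_dom bU)).2 (supp_hat_dom bU fc).
exists a; split; rewrite ?ay//.
have [y' y'c] := surj (rng c).
suff -> : rng a = y' by [].
apply: (cpt_open_separate ampleF.2) => K cK Ka; apply/(y'c _ cK).
have [cU Ud _ _] := bU.
have oK : open (@rng F @^-1` K).
  by move/continuousP : (@rng_continuous F); apply; exact: cK.1.
have kK : closed (@rng F @^-1` K).
  have c0 := cpt_open_closed ampleF.2.1 cK.
  by apply: preimage_closed => // b _; exact: rng_continuous.
have cL := cpt_open_dom ampleF (cpt_openI hF cU oK kK).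
(* Keeping the arrows of [U] with range in [K] is the same as keeping those with source in a
   suitable set. [Psi] preserves this equality; at [c] the source condition holds since [dom a]
   corresponds to [dom c], which forces the range condition. *)
have : Psi (conv (ind R (idn @` K)) (ind R U)) c =
    Psi (conv (ind R U) (ind R (idn @` (dom @` (U `&` rng @^-1` K))))) c.
  congr (Psi _ c); apply/funext => b; rewrite conv_idnl conv_idnr.
  have [Ub|nUb] := pselect (U b); last by rewrite (ind0 _ nUb) mulr0 mul0r.
  rewrite (ind1 _ Ub) mulr1 mul1r.
  have [Kb|nKb] := pselect (K (rng b)); first by rewrite !ind1//; exists b.
  rewrite !ind0// => -[b' [Ub' Kb'] /Ud]; rewrite !inE => /(_ Ub' Ub) bb.
  by apply: nKb; rewrite -bb.
rewrite psi_idnl ?psi_idnr//; [|exact: algU|exact: algU].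
rewrite (ind1 R (_ : hat _ (dom c))); last by apply/(yc _ cL); exists a.
rewrite mulr1 => e; apply/(ind_neq0 R); apply: contra_neq fc => z.
by rewrite -e z mul0r.
Qed.

Lemma psi_deg U a c : bisection U -> U a -> f_ U c != 0 -> deg c = deg a.
Proof.
move=> bU Ua fc; have [_ _ _ [g Ug]] := bU.
have [_] : homogeneous g (f_ U).
  apply: (hom_deg hPsi); split; first exact: algU.
  by move=> b /(ind_neq0 R)/Ug.
by move=> /(_ _ fc) /= ->; rewrite Ug.
Qed.

Lemma conv_psi_ginvl U : bisection U ->
  conv (f_ (@ginv F @` U)) (f_ U) = ind R (idn @` hat (dom @` U)).
Proof.
move=> bU; have bV := bisection_ginv bU; have [_ _ Ur _] := bU.
rewrite -(hom_conv hPsi); [|exact: algU|exact: algU].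
rewrite conv_bisection// -psi_idn; last exact: bisection_dom.
congr (Psi (ind R _)); apply/seteqP; split.
  move=> _ [_ [b [[a Ua <-] Ub e ->]]].
  have -> : a = b by apply: Ur; rewrite ?inE// -e dom_inv.
  by rewrite gmulVa; exists (dom b) => //; exists b.
move=> _ [_ [a Ua <-] <-].
by exists (ginv a), a; split; rewrite ?dom_inv ?gmulVa//; exists a.
Qed.

Lemma conv_psi_ginvr U : bisection U ->
  conv (f_ U) (f_ (@ginv F @` U)) = ind R (idn @` hat (rng @` U)).
Proof.
move=> bU; have bV := bisection_ginv bU; have [_ Ud _ _] := bU.
rewrite -(hom_conv hPsi); [|exact: algU|exact: algU].
rewrite conv_bisection// -psi_idn; last exact: bisection_rng.
congr (Psi (ind R _)); apply/seteqP; split.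
  move=> _ [b [_ [Ub [a Ua <-] e ->]]].
  have -> : b = a by apply: Ud; rewrite ?inE// e rng_inv.
  by rewrite gmulaV; exists (rng a) => //; exists a.
move=> _ [_ [a Ua <-] <-].
by exists a, (ginv a); split; rewrite ?rng_inv ?gmulaV//; exists a.
Qed.

Lemma supp_rng U c d : bisection U -> f_ U c != 0 -> f_ U d != 0 ->
  dom c = dom d -> rng c = rng d.
Proof.
move=> bU /(supp_pt bU)[a [Ua ad ar]] /(supp_pt bU)[b [Ub bd br]] e.
have [_ Ud _ _] := bU.
have ab : a = b by apply: Ud; rewrite ?inE//; apply: (pt_inj ad); rewrite e.
by apply: (pt_fun ar); rewrite ab.
Qed.

(** If [c] and [d] differ, take disjoint open neighbourhoods. The sources of the arrows of the
    support in each form open sets containing [dom c], so density yields a common source at which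
    [unit_fibre] identifies an arrow of one with an arrow of the other. *)
Lemma psi_uniq U c d : bisection U -> f_ U c != 0 -> f_ U d != 0 ->
  dom c = dom d -> c = d.
Proof.
move=> bU fc fd cd; have bV := bisection_ginv bU.
have fA : groupoid_algebra (f_ U) by apply: (hom_alg hPsi); exact: algU.
have fA' : groupoid_algebra (f_ (@ginv F @` U)).
  by apply: (hom_alg hPsi); exact: algU.
have [lf _] := (algP _).1 fA.
apply: contrapT => /eqP ncd; have := hE; rewrite open_hausdorff => /(_ _ _ ncd).
move=> [[A B] /= [/set_mem Ac /set_mem Bd] [oA oB /eqP AB]].
have oS := lc_supp_open lf.
have [_ Ud Ur _] := bU.
pose O := dom @` (A `&` supp (f_ U)) `&` dom @` (B `&` supp (f_ U)).
have oO : open O by apply: openI; apply: open_dom => //; exact: openI.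
have O0 : O !=set0.
  by exists (dom c); split; [exists c | exists d].
have [x [[[c' [Ac' fc'] c'x] [d' [Bd' fd'] d'x]] nu]] := units_dense O0 oO.
suff e : c' = d'.
  by move: AB; rewrite -subset0 => /(_ c'); apply; split => //; rewrite e.
apply: (unit_fibre hE fA fA' _ _ _ _ (conv_psi_ginvr bU) (conv_psi_ginvl bU)
  nu) => //.
(* Composable arrows of the two supports lie over mutually inverse arrows of [F], so their product
   is isotropic of degree 1. *)
- move=> a b fa fb ab.
  have [_ [[u Uu <-]]] := supp_pt bV fa; rewrite dom_inv rng_inv => ur ud.
  have [v [Uv vd vr]] := supp_pt bU fb.
  have uv : u = v by apply: Ur; rewrite ?inE//; apply: (pt_inj ur); rewrite ab.
  split; last by rewrite dom_mul// rng_mul//; apply: (pt_fun vd); rewrite -uv.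
  have Vu : (@ginv F @` U) (ginv u) by exists u.
  by rewrite degM// (psi_deg bV Vu fa) (psi_deg bU Uv fb) deg_inv uv mulVg.
- move=> a b fa fb ab.
  have [u [Uu ud ur]] := supp_pt bU fa.
  have [v [Uv vd vr]] := supp_pt bU fb.
  have uv : u = v by apply: Ur; rewrite ?inE//; apply: (pt_inj ur); rewrite ab.
  have e : dom (ginv a) = rng b by rewrite dom_inv.
  split; last first.
    by rewrite dom_mul// rng_mul// rng_inv; apply: (pt_fun vd); rewrite -uv.
  by rewrite degM// deg_inv (psi_deg bU Uu fa) (psi_deg bU Uv fb) uv mulVg.
- by move=> a b fa fb; exact: supp_rng fa fb.
- move=> a fa; have [u [Uu ud ur]] := supp_pt bU fa.
  split; first by apply/(ur _ (bisection_rng bU)); exists u.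
  by apply/(ud _ (bisection_dom bU)); exists u.
Qed.

(** By [psi_uniq] only [c] contributes to the convolution at [idn (dom c)]. Values on the support
    are thus invertible, which excludes vanishing products. *)
Lemma psi_ginv U c : bisection U -> f_ U c != 0 ->
  f_ (@ginv F @` U) (ginv c) * f_ U c = 1.
Proof.
move=> bU fc; rewrite -(@conv_uniq_dom R G E); last 2 first.
- by rewrite dom_inv.
- by move=> d fd dc; apply: (psi_uniq bU).
rewrite gmulVa conv_psi_ginvl// ind_idn ind1//; exact: supp_hat_dom.
Qed.

Definition arel a c :=
  pt (dom a) (dom c) /\ exists U, [/\ bisection U, U a & f_ U c != 0].

(** Over the sources of the intersection of two bisections both functions agree with the image of
    the indicator of that intersection, so the choice of bisection is immaterial. *)
Lemma arelP a c : arel a c -> forall U, bisection U -> U a -> f_ U c != 0.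
Proof.
move=> [ac [V [bV Va fc]]] U bU Ua.
have [cU Ud _ _] := bU; have [cV Vd _ _] := bV.
have bW : bisection (U `&` V).
  by apply: (bisectionS bU) => [|b []//]; exact: cpt_openII.
have cW := bisection_dom bW.
have hW : hat (dom @` (U `&` V)) (dom c) by apply/(ac _ cW); exists a.
have -> : f_ U c = f_ (U `&` V) c.
  rewrite -[LHS]mulr1 -(ind1 R hW) -psi_restrict//; congr (Psi (ind R _) c).
  apply/seteqP; split => [b [Ub [b' [Ub' Vb'] /Ud]]|b [Ub Vb]].
    by rewrite !inE => /(_ Ub' Ub) <-.
  by split => //; exists b.
have <- : f_ V c = f_ (U `&` V) c; last by [].
rewrite -[LHS]mulr1 -(ind1 R hW) -psi_restrict//; congr (Psi (ind R _) c).
apply/seteqP; split => [b [Vb [b' [Ub' Vb'] /Vd]]|b [Ub Vb]].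
  by rewrite !inE => /(_ Vb' Vb) <-.
by split => //; exists b.
Qed.

(** The convolution is 1 at [idn x], so it has a non-zero term, whose right factor is an arrow of
    the support with source [x]. *)
Lemma arel_total a : exists c, arel a c.
Proof.
have [U [bU Ua _]] := bisection_nbhs ampleF (@filterT _ (nbhs a) _).
have [x ax] := pt_total (dom a).
have : conv (f_ (@ginv F @` U)) (f_ U) (idn x) != 0.
  rewrite conv_psi_ginvl// ind_idn; apply/ind_neq0/(ax _ (bisection_dom bU)).
  by exists a.
move=> /conv_neq0[c [d [cd e _ fd]]]; exists d; split; last by exists U.
by rewrite -(dom_mul cd) -e dom_idn.
Qed.

Lemma arel_fun a c d : arel a c -> arel a d -> c = d.
Proof.
move=> ac [ad [U [bU Ua fd]]]; apply: (psi_uniq bU) => //; first exact: (arelP ac).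
exact: (pt_fun ac.1).
Qed.

Lemma arel_rng a c : arel a c -> pt (rng a) (rng c).
Proof.
move=> [ac [U [bU Ua fc]]]; have [b [Ub bd br]] := supp_pt bU fc.
have [_ Ud _ _] := bU.
by rewrite (Ud a b) ?inE//; exact: pt_inj ac bd.
Qed.

Lemma arel_deg a c : arel a c -> deg c = deg a.
Proof. by move=> [_ [U [bU Ua fc]]]; exact: psi_deg fc. Qed.

Lemma arel_dom_rng a b c d : arel a c -> arel b d -> dom a = rng b -> dom c = rng d.
Proof. by move=> [ac _] bd e; apply: (pt_fun ac); rewrite e; exact: arel_rng. Qed.

Lemma arelM a b c d : arel a c -> arel b d -> dom a = rng b ->
  arel (gmul a b) (gmul c d).
Proof.
move=> ac bd ab; have cd := arel_dom_rng ac bd ab.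
have [_ [U [bU Ua fc]]] := ac; have [bd' [V [bV Vb fd]]] := bd.
split; first by rewrite !dom_mul.
exists (sprod U V); split; first exact: bisection_sprod.
  by exists a, b.
rewrite -conv_bisection// (hom_conv hPsi); [|exact: algU|exact: algU].
rewrite conv_uniq_dom//; last by move=> d' fd' e; apply: (psi_uniq bV).
(* Were the product zero, multiplying it by the inverse of the value at [c] would make the value at
   [d] vanish. *)
apply: contra_neq fd => z; rewrite -[LHS]mul1r -(psi_ginv bU fc) -mulrA.
by rewrite z mulr0.
Qed.

Lemma arel_idn y x : pt y x -> arel (idn y) (idn x).
Proof.
move=> yx; split; first by rewrite !dom_idn.
have [K [cK Ky _]] := cpt_open_nbhs ampleF.2 (@filterT _ (nbhs y) _).
exists (idn @` K); split; first exact: bisection_idn; first by exists y.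
by rewrite psi_idn// ind_idn; apply/ind_neq0/(yx _ cK).
Qed.

Lemma arel_ginv a c : arel a c -> arel (ginv a) (ginv c).
Proof.
move=> ac; have [_ [U [bU Ua fc]]] := ac.
split; first by rewrite !dom_inv; exact: arel_rng.
exists (ginv @` U); split; [exact: bisection_ginv | by exists a |].
apply: contraTneq (oner_neq0 R) => z.
by rewrite -(psi_ginv bU fc) z mul0r eqxx.
Qed.

(* Near [a], the image of [U] is supported on units, hence diagonal; applying
   the diagonal-preserving inverse shows that [U] consists of units near [a]. *)
Lemma arel_ker a x : arel a (idn x) -> a = idn (dom a).
Proof.
move=> [ax [U [bU Ua fx]]].
have [lf _] : groupoid_algebra (f_ U) by apply: (hom_alg hPsi); exact: algU.
have nS : nbhs x (idn @^-1` supp (f_ U)).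
  apply: (@idn_continuous E x); apply: open_nbhs_nbhs.
  by split => //; exact: lc_supp_open.
have [L [cL Lx LS]] := cpt_open_nbhs ampleE.2 nS.
have cK : cpt_open (hatPhi L) := cpt_open_hat ampleF ampleE hE hPhi cL.
have LK := hatK indecR ampleF ampleE hE hPhi PhiK cL.
have bU' : groupoid_algebra (ind R (U `&` dom @^-1` hatPhi L)).
  apply: alg_ind1 => //; have [cU _ _ _] := bU; apply: cpt_openI => //.
    by move/continuousP : (@dom_continuous F); apply; exact: cK.1.
  have c0 := cpt_open_closed ampleF.2.1 cK.
  by apply: preimage_closed => // b _; exact: dom_continuous.
have : Defs.diagonal (Phi (f_ (U `&` dom @^-1` hatPhi L))).
  apply: (hom_diag hPhi); split; first exact: (hom_alg hPsi).
  move=> c; rewrite /supp /= psi_restrict// LK => nz.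
  have fc : f_ U c != 0 by apply: contra_neq nz => ->; rewrite mul0r.
  have Lc : L (dom c).
    by apply/(ind_neq0 R); apply: contra_neq nz => ->; rewrite mulr0.
  exists (dom c) => //; apply: (psi_uniq bU) => //; last by rewrite dom_idn.
  exact: LS.
rewrite PsiK// => -[_ /(_ a)]; case.
  rewrite /supp /=; apply/ind_neq0; split => //=.
  by have p := ptC ax; apply/(p _ cL); rewrite dom_idn.
by move=> y _ <-; rewrite dom_idn.
Qed.

Lemma arel_inj a b c : arel a c -> arel b c -> a = b.
Proof.
move=> ac bc; have ab : dom a = dom b by exact: pt_inj ac.1 bc.1.
have e : dom a = rng (ginv b) by rewrite rng_inv.
have := arelM ac (arel_ginv bc) e; rewrite gmulaV => /arel_ker.
rewrite dom_mul// dom_inv => E1.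
have := gmulKV ab; rewrite E1 gmul_idl => -> //.
Qed.

(** For a bisection [V] around [c], [Phi] of its indicator is a sum of scalar multiples of
    indicators, and the image under [Psi] of some summand is non-zero at [c]. *)
Lemma arel_surj c : exists a, arel a c.
Proof.
suff [U bU fc] : exists2 U, bisection U & f_ U c != 0.
  by have [a [Ua ad _]] := supp_pt bU fc; exists a; split => //; exists U.
have [V [bV Vc _]] := bisection_nbhs ampleE (@filterT _ (nbhs c) _).
have VA : groupoid_algebra (ind R V) by exact: bisection_alg.
have : Psi (Phi (ind R V)) c != 0 by rewrite PhiK// ind1// oner_neq0.
have := hom_alg hPhi VA; move: (Phi _).
apply: (alg_ind ampleF hF).
- by rewrite hom0// eqxx.
- move=> f g fA gA If Ig; rewrite (hom_add hPsi)//=.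
  by have [->|/If//] := eqVneq (Psi f c) 0; rewrite add0r.
- move=> r U bU nz; exists U => //.
  have cU := bisection_rng bU.
  (* [Psi] need not commute with scalars, so [r] is moved to the units over the ranges of [U]; the
     image is then a diagonal function times [Psi] of the indicator of [U]. *)
  have dA : Defs.diagonal (fun a => r * ind R (@idn F @` (rng @` U)) a).
    split; last first.
      move=> a; rewrite /supp /= => ra; apply: (@supp_ind_idn R G F (rng @` U)).
      by apply: contra_neq ra => ->; rewrite mulr0.
    rewrite (_ : (fun a => _) = fun a => ind R (@idn F @` (rng @` U)) a * r).
      by apply: alg_mulr; [exact: alg_idn | move=> a; exact: nearW].
    by apply/funext => a; rewrite mulrC.
  have e : (fun a => r * ind R U a) =
      conv (fun a => r * ind R (@idn F @` (rng @` U)) a) (ind R U).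
    apply/funext => a; rewrite conv_diagl; last exact: dA.2.
    have [Ua|nUa] := pselect (U a); last by rewrite (ind0 _ nUa) !mulr0.
    by rewrite (ind1 _ Ua) ind_idn ind1 ?mulr1//; exists a.
  move: nz; rewrite e (hom_conv hPsi); [|exact: dA.1|exact: algU].
  rewrite conv_diagl; last exact: (hom_diag hPsi dA).2.
  by apply: contra_neq => ->; rewrite mulr0.
Qed.

(** Continuity from [F] to [E]: sources of arrows of the support inside [O] fill a compact open [L]
    around [dom c], and each [b] in [U] with source in [hatPhi L] is related to such an arrow. *)
Lemma arel_near_l a c (O : set (arr E)) : arel a c -> nbhs c O ->
  \forall b \near a, exists2 d, arel b d & O d.
Proof.
move=> ac nO; have [acd [U [bU Ua fc]]] := ac; have [cU _ _ _] := bU.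
have [lf _] : groupoid_algebra (f_ U) by apply: (hom_alg hPsi); exact: algU.
have nV : nbhs (dom c) (dom @` (O° `&` supp (f_ U))).
  apply: open_nbhs_nbhs; split; last by exists c => //; split.
  apply: open_dom => //; apply: openI; last exact: lc_supp_open.
  exact: open_interior.
have [L [cL Lc LV]] := cpt_open_nbhs ampleE.2 nV.
have cK := cpt_open_hat ampleF ampleE hE hPhi cL.
have nK : \forall b \near a, hatPhi L (dom b).
  apply: (@dom_continuous F a); apply: open_nbhs_nbhs; split; first exact: cK.1.
  by have p := ptC acd; apply/(p _ cL).
apply: filterS2 (open_nbhs_nbhs (conj cU.1 Ua)) nK => b Ub Kb.
have [x bx] := pt_total (dom b).
have [d [Od fd] dx] : (dom @` (O° `&` supp (f_ U))) x.
  by apply: LV; have p := ptC bx; apply/(p _ cL).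
exists d; last exact: interior_subset Od.
by split; [rewrite dx | exists U].
Qed.

(** Continuity from [E] to [F]: the support is open, each of its arrows is related to an arrow of
    [U], and [U] can be taken inside [O]. *)
Lemma arel_near_r a c (O : set (arr F)) : arel a c -> nbhs a O ->
  \forall d \near c, exists2 b, arel b d & O b.
Proof.
move=> ac nO; have [U [bU Ua UO]] := bisection_nbhs ampleF nO.
have fc := arelP ac bU Ua.
have [lf _] : groupoid_algebra (f_ U) by apply: (hom_alg hPsi); exact: algU.
apply: filterS (lf c) => d e; have fd : f_ U d != 0 by rewrite e.
have [b [Ub bd _]] := supp_pt bU fd.
exists b; last exact: UO.
by split => //; exists U.
Qed.

Lemma graded_iso_of_hom :
  exists phi : groupoidFunctor E F, graded_groupoid_iso phi.
Proof.
have [p0 p0P] := choice surj.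
have [q0 q0P] := choice pt_total.
have [p1 p1P] := choice arel_surj.
have [q1 q1P] := choice arel_total.
have p0E y x : pt y x -> p0 x = y by apply: pt_inj; exact: p0P.
have q0E y x : pt y x -> q0 y = x by apply: pt_fun; exact: q0P.
have p1E a c : arel a c -> p1 c = a by apply: arel_inj; exact: p1P.
have q1E a c : arel a c -> q1 a = c by apply: arel_fun; exact: q1P.
have pd c : dom (p1 c) = p0 (dom c) by apply/esym/p0E; case: (p1P c).
have pr c : rng (p1 c) = p0 (rng c) by apply/esym/p0E; exact: arel_rng.
have pi x : p1 (idn x) = idn (p0 x) by apply: p1E; exact: arel_idn.
have pm c d : dom c = rng d -> p1 (gmul c d) = gmul (p1 c) (p1 d).
  by move=> e; apply: p1E; apply: arelM => //; rewrite pd pr e.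
have qd a : dom (q1 a) = q0 (dom a) by apply/esym/q0E; case: (q1P a).
have qr a : rng (q1 a) = q0 (rng a) by apply/esym/q0E; exact: arel_rng.
have qi y : q1 (idn y) = idn (q0 y) by apply: q1E; exact: arel_idn.
have qm a b : dom a = rng b -> q1 (gmul a b) = gmul (q1 a) (q1 b).
  by move=> e; apply: q1E; apply: arelM.
pose phi : groupoidFunctor E F := GroupoidFunctor pd pr pi pm.
pose psi : groupoidFunctor F E := GroupoidFunctor qd qr qi qm.
have cp1 : continuous p1.
  move=> c O nO; apply: filterS (arel_near_r (p1P c) nO) => d [b bd Ob].
  by rewrite /= (p1E _ _ bd).
have cq1 : continuous q1.
  move=> a O nO; apply: filterS (arel_near_l (q1P a) nO) => b [d bd Od].
  by rewrite /= (q1E _ _ bd).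
(* Object maps are recovered from arrow maps through units and sources, and inherit their
   continuity. *)
have cp0 : continuous p0.
  rewrite (_ : p0 = dom \o (p1 \o idn)); last first.
    by apply/funext => x /=; rewrite pd dom_idn.
  move=> x; apply: continuous_comp; last exact: dom_continuous.
  by apply: continuous_comp; [exact: idn_continuous | exact: cp1].
have cq0 : continuous q0.
  rewrite (_ : q0 = dom \o (q1 \o idn)); last first.
    by apply/funext => y /=; rewrite qd dom_idn.
  move=> y; apply: continuous_comp; last exact: dom_continuous.
  by apply: continuous_comp; [exact: idn_continuous | exact: cq1].
exists phi; split; last by move=> c /=; rewrite -(arel_deg (p1P c)).
split; first by split.
exists psi; split; first by split.
- by move=> x /=; exact: q0E.
- by move=> y /=; exact: p0E.
- by move=> c /=; exact: q1E.
- by move=> a /=; exact: p1E.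
Qed.

End Reconstruction.

Theorem theorem5p7 (G : groupType) (R : comNzRingType)
    (E E' : gradedGroupoid G)
    (indecR : indecomposable R)
    (ampleE : ample E) (hausE : hausdorff_space (arr E))
    (ampleE' : ample E') (hausE' : hausdorff_space (arr E'))
    (units_dense : dense (fun x : obj E =>
       no_nontrivial_units R (isotropy_group (proj1 ampleE) x))) :
  ((exists phi : groupoidFunctor E E', graded_groupoid_iso phi) <->
   (exists Phi : (arr E -> R) -> (arr E' -> R),
      [/\ algebra_iso Phi, diagonal_preserving Phi & graded_map Phi])) /\
  ((exists Phi : (arr E -> R) -> (arr E' -> R),
      [/\ algebra_iso Phi, diagonal_preserving Phi & graded_map Phi]) <->
   (exists Phi : (arr E -> R) -> (arr E' -> R),
      [/\ ring_iso Phi, diagonal_preserving Phi & graded_map Phi])).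
Proof.
have iso21 : (exists phi : groupoidFunctor E E', graded_groupoid_iso phi) ->
    exists Phi : (arr E -> R) -> (arr E' -> R),
      [/\ algebra_iso Phi, diagonal_preserving Phi & graded_map Phi].
  by move=> [phi]; exact: iso_algebra_iso.
have iso32 : (exists Phi : (arr E -> R) -> (arr E' -> R),
      [/\ algebra_iso Phi, diagonal_preserving Phi & graded_map Phi]) ->
    exists Phi : (arr E -> R) -> (arr E' -> R),
      [/\ ring_iso Phi, diagonal_preserving Phi & graded_map Phi].
  by move=> [Phi [[rPhi _] dPhi gPhi]]; exists Phi.
have iso13 : (exists Phi : (arr E -> R) -> (arr E' -> R),
      [/\ ring_iso Phi, diagonal_preserving Phi & graded_map Phi]) ->
    exists phi : groupoidFunctor E E', graded_groupoid_iso phi.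
  move=> [Phi [rPhi dPhi gPhi]].
  have [Psi [hPhi hPsi PsiK PhiK]] := ring_iso_inverse ampleE hausE rPhi dPhi gPhi.
  exact: (graded_iso_of_hom indecR hausE ampleE' hausE' hPsi hPhi PsiK PhiK
    units_dense).
split; split; [exact: iso21 | by move=> /iso32/iso13 | exact: iso32 |].
by move=> /iso13/iso21.
Qed.
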